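(* Consider an $s$-stage, $p$-th order implicit Runge-Kutta scheme $(A,\vec b,\vec c)$ with weak stage order $\tilde q\ge 1$, and an operator $\mathcal{L}$, satisfying assumptions (a)-(e) of the context. Then the convergence order for time-periodic solutions with conventional boundary conditions is $\min\{p,\tilde q+1\}$; that is, for fixed real $\omega\ne0$, the spatial part $\epsilon_0(x)$ of the periodic global error (defined in the context) satisfies $$\epsilon_0=O\big(\Delta t^{\min\{p,\tilde q+1\}}\big)\quad\text{in } L^\infty(\Omega)\text{ as }\Delta t\to0.$$
   Context: Scheme. A Runge-Kutta (RK) scheme is given by $A\in\mathbb{R}^{s\times s}$, $\vec b\in\mathbb{R}^s$; $\vec e=(1,\dots,1)^T$, $\vec c=A\vec e$; powers of vectors are componentwise. It has order $p$ ($p\geq 1$), which in particular means $\vec b^{\,T}A^j\vec c^{\,k}=\frac{1}{(j+k+1)(j+k)\cdots(k+1)}$ for all $j,k\ge0$ with $j+k\le p-1$. Its stability function is $R(\zeta)=1+\zeta\,\vec b^{\,T}(I-\zeta A)^{-1}\vec e$, and its stability region is $\{\zeta\in\mathbb{C}:|R(\zeta)|\le1\}$. The stage order residuals are $\vec\tau^{(j)}=A\vec c^{\,j-1}-\frac1j\vec c^{\,j}$, $j\ge1$. The scheme has weak stage order $\tilde q\ge1$ if there is a vector space $\mathcal V\subseteq\mathbb{R}^s$ containing $\vec\tau^{(j)}$ for $1\le j\le\tilde q$ such that $\vec b^{\,T}\vec v=0$ and $A\vec v\in\mathcal V$ for all $\vec v\in\mathcal V$. Problem. $u_t=\mathcal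 L u+f$ on $\Omega=(0,1)$ with Dirichlet condition $u=g$ on $\partial\Omega$, $\mathcal L$ a linear second-order differential operator (with time-independent coefficients). For $0<\theta\le\pi/2$ let $W_e(\theta)=\{\lambda\in\mathbb{C}\setminus\{0\}:|\arg(-\lambda)|<\theta\}$. Assumptions. (a) There are constants $K$ and $0<\theta_1<\pi/2$ such that for every $\lambda\notin W_e(\theta_1)$ the operator $I-\lambda\mathcal L$ with homogeneous boundary conditions has an inverse with $\|(I-\lambda\mathcal L)^{-1}u\|_{L^\infty}\le K\|u\|_{L^\infty}$. (b) The scheme's stability region includes $W_e(\theta_2)$ for some $\theta_2>\theta_1$ ($\theta_2\le\pi/2$). (c) The eigenvalues of $A$ have non-negative real parts. (d) There are $\delta_d,c_d>0$ such that for every complex $w$ with $|w|<\delta_d$ the matrix $\vec e\,\vec b^{\,T}+wA$ is diagonalizable and eigenvector matrices $T(w)$ can be selected with $\|T(w)\|\|T(w)^{-1}\|<c_d$. (e) $A$ is invertible and $\vec b^{\,T}A^{-1}\vec e\ne0$. Periodic error. Let $f=\hat f(x)e^{\mathrm i\omega t}$, $g=\hat g e^{\mathrm i\omega t}$ with $\omega\in\mathbb{R}$, $\omega\neq0$ fixed, and let $u^*(x,t)=U^*(x)e^{\mathrm i\omega t}$ be the periodic exact solution, where $(\mathrm i\omega-\mathcal L)U^*=\hat f$ in $\Omega$, $U^*=\hat g$ on $\partial\Omega$; $U^*$ is assumed sufficiently smooth on $\overline\Omega$. One RK step is $\vec u^{\,n+1}=u^n\vec e+\Delta t\,A(\mathcal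 L\vec u^{\,n+1}+\vec f^{\,n+1})$, $u^{n+1}=u^n+\Delta t\,\vec b^{\,T}(\mathcal L\vec u^{\,n+1}+\vec f^{\,n+1})$, with $f^{n+1}_i=f(\cdot,t_n+c_i\Delta t)$, $t_n=n\Delta t$. Conventional boundary conditions are imposed on the stages: $u_i^{n+1}=g(t_n+c_i\Delta t)$ on $\partial\Omega$; no boundary condition is imposed on $u^{n+1}$. Put $z=e^{\mathrm i\omega\Delta t}$. The periodic numerical solution has error $u^n-u^*(\cdot,t_n)=\epsilon_0(x)z^n$ and stage errors $u_i^{n}-u^*(\cdot,t_{n-1}+c_i\Delta t)=\epsilon_i(x)z^n$, so that $\epsilon_0$ and $\vec\epsilon=(\epsilon_1,\dots,\epsilon_s)^T$ are determined (for small $\Delta t$) by $$\vec\epsilon-z^{-1}\epsilon_0\vec e-\Delta t\,A\mathcal L\vec\epsilon=z^{-1}\vec\delta,\qquad (z-1)\epsilon_0=z\,\Delta t\,\vec b^{\,T}\mathcal L\vec\epsilon+\delta_0,\qquad \vec\epsilon=0\text{ on }\partial\Omega,$$ where $\vec\delta(x)=U^*(x)\sum_{j\ge1}\frac{(\mathrm i\omega)^j\Delta t^j}{(j-1)!}\vec\tau^{(j)}$ and $\delta_0(x)=U^*(x)\sum_{j\ge1}\frac{(\mathrm i\omega)^j\Delta t^j}{(j-1)!}\big(\vec b^{\,T}\vec c^{\,j-1}-\frac1j\big)$. *)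

(* Defs.v *)
From HB Require Import structures.
From mathcomp Require Import all_boot all_order all_algebra.
From mathcomp Require Import all_classical all_reals all_analysis.
From mathcomp Require Import ess_sup_inf complex.

Set Implicit Arguments.
Unset Strict Implicit.
Unset Printing Implicit Defensive.

Import Order.TTheory GRing.Theory Num.Theory.
Import numFieldNormedType.Exports.

Local Open Scope classical_set_scope.
Local Open Scope ring_scope.
Local Open Scope complex_scope.

(* Butcher's order conditions: a scheme has order (at least) p iff
   b^T Phi(t) = 1 / gamma(t) for all rooted trees t with at most p nodes.  The
   tree formed by a chain of j nodes above a node carrying k leaves gives
   b^T A^j c^k = 1 / ((j+k+1)(j+k)...(k+1)). *)
Inductive rtree : Type := RNode of seq rtree.

Fixpoint rtree_order (t : rtree) : nat :=
  let: RNode ts := t in (sumn (map rtree_order ts)).+1.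

Fixpoint rtree_density (t : rtree) : nat :=
  let: RNode ts := t in
  (rtree_order t * \prod_(g <- map rtree_density ts) g)%N.

Section RungeKutta.
Context {R : realType} {s : nat}.
Implicit Types (A : 'M[R]_s) (b : 'cV[R]_s).

Definition ones : 'cV[R]_s := const_mx 1.
Definition abscissae A : 'cV[R]_s := A *m ones.
Definition cvpow (c : 'cV[R]_s) (k : nat) : 'cV[R]_s :=
  map_mx (fun x => x ^+ k) c.

Fixpoint stage_weight A (t : rtree) : 'cV[R]_s :=
  let: RNode ts := t in
  \col_i \prod_(v <- map (stage_weight A) ts) (A *m v) i 0.

Definition has_order A b (p : nat) : Prop :=
  forall t : rtree, (rtree_order t <= p)%N ->
    (b^T *m stage_weight A t) 0 0 = (rtree_density t)%:R^-1.

(* tau^(j), meaningful for j >= 1 *)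
Definition stage_residual A (j : nat) : 'cV[R]_s :=
  A *m cvpow (abscissae A) j.-1 - j%:R^-1 *: cvpow (abscissae A) j.

Definition has_weak_stage_order A b (q : nat) : Prop :=
  exists V : {vspace 'cV[R]_s},
    (forall j, (1 <= j <= q)%N -> stage_residual A j \in V) /\
    (forall v, v \in V -> b^T *m v = 0 /\ A *m v \in V).

Definition cmx m n (M : 'M[R]_(m, n)) : 'M[R[i]]_(m, n) :=
  map_mx (real_complex R) M.

Definition stability_function A b (zeta : R[i]) : R[i] :=
  1 + zeta * ((cmx b)^T *m invmx (1%:M - zeta *: cmx A) *m cmx ones) 0 0.

(* Points where I - zeta A is singular (where invmx is junk) are excluded. *)
Definition stability_region A b : set R[i] :=
  [set zeta | 1%:M - zeta *: cmx A \in unitmx /\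
              Normc.normc (stability_function A b zeta) <= 1].

(* the matrix norm induced by the maximum norm on vectors *)
Definition mxopnorm (M : 'M[R[i]]_s) : R :=
  \big[Num.max/0]_(i < s) \sum_(j < s) Normc.normc (M i j).

(* The columns of T are eigenvectors of M. *)
Definition diagonalized_by (T M : 'M[R[i]]_s) : Prop :=
  T \in unitmx /\ is_diag_mx (invmx T *m M *m T).

Definition uniformly_diagonalizable A b (delta_d c_d : R) : Prop :=
  forall w : R[i], Normc.normc w < delta_d ->
    exists T : 'M[R[i]]_s,
      diagonalized_by T (cmx ones *m (cmx b)^T + w *: cmx A) /\
      mxopnorm T * mxopnorm (invmx T) < c_d.

End RungeKutta.

Section Complex.
Context {R : realType}.

(* principal argument, in ]-pi, pi] *)
Definition carg (z : R[i]) : R :=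
  let phi := acos (complex.Re z / Normc.normc z) in
  if 0 <= complex.Im z then phi else - phi.

Definition wedge (theta : R) : set R[i] :=
  [set lambda | lambda != 0 /\ `|carg (- lambda)| < theta].

Definition expi (t : R) : R[i] := cos t +i* sin t.

Definition cseries (a : nat -> R[i]) : R[i] :=
  limn (series (fun n => complex.Re (a n))) +i*
  limn (series (fun n => complex.Im (a n))).

Definition cderivable (u : R -> R[i]) (x : R) : Prop :=
  derivable (fun y => complex.Re (u y)) x 1 /\
  derivable (fun y => complex.Im (u y)) x 1.

Definition cderive (u : R -> R[i]) (x : R) : R[i] :=
  derive1 (fun y => complex.Re (u y)) x +i*
  derive1 (fun y => complex.Im (u y)) x.

End Complex.

(* Functions on Omega = ]0, 1[ are represented by functions on R whose values
   outside [0, 1] are irrelevant. *)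
Section FunctionSpaces.
Context {R : realType}.
Implicit Types (u f : R -> R[i]).

Definition Omega : set R := [set x | 0 < x < 1].
Definition clOmega : set R := [set x | 0 <= x <= 1].

Definition aeOmega (P : R -> Prop) : Prop :=
  {ae (@lebesgue_measure R), forall x, Omega x -> P x}.

Definition Linf_norm u : \bar R :=
  ess_sup (@lebesgue_measure R)
    (EFin \o ((fun x => Normc.normc (u x)) \_ Omega)).

Definition in_Linf u : Prop :=
  [/\ measurable_fun Omega (fun x => complex.Re (u x)),
      measurable_fun Omega (fun x => complex.Im (u x)) &
      (Linf_norm u < +oo)%E].

(* W^{2,oo}(Omega), through the representative that is continuous on [0, 1]:
   u is C^1 on Omega with a Lipschitz derivative.  The a.e. derivability of u'
   is automatic (Rademacher); it is included for convenience. *)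
Definition in_W2inf u : Prop :=
  [/\ {within clOmega, continuous (fun x => complex.Re (u x))} /\
      {within clOmega, continuous (fun x => complex.Im (u x))},
      forall x, Omega x -> cderivable u x,
      exists k : R, forall x y, Omega x -> Omega y ->
        Normc.normc (cderive u x - cderive u y) <= k * `|x - y| &
      aeOmega (cderivable (cderive u))].

Definition C2_closed u : Prop :=
  exists v : R -> R[i],
    (forall x, clOmega x -> u x = v x) /\
    (forall x, [/\ cderivable v x, cderivable (cderive v) x,
        {for x, continuous (fun y => complex.Re (cderive (cderive v) y))} &
        {for x, continuous (fun y => complex.Im (cderive (cderive v) y))}]).

(* L u = coef2 u'' + coef1 u' + coef0 u *)
Record diffop := DiffOp {
  coef2 : R -> R[i];
  coef1 : R -> R[i];
  coef0 : R -> R[i] }.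

Definition second_order (L : diffop) : Prop :=
  [/\ in_Linf (coef2 L), in_Linf (coef1 L), in_Linf (coef0 L) &
      ~ aeOmega (fun x => coef2 L x = 0)].

Definition apply_op (L : diffop) u (x : R) : R[i] :=
  coef2 L x * cderive (cderive u) x + coef1 L x * cderive u x +
  coef0 L x * u x.

Definition homogeneous_domain u : Prop :=
  [/\ in_W2inf u, u 0 = 0 & u 1 = 0].

Definition resolvent_solution (L : diffop) (lambda : R[i]) f u : Prop :=
  homogeneous_domain u /\
  aeOmega (fun x => u x - lambda * apply_op L u x = f x).

(* For lambda = 0 the operator is the identity, whose restriction to functions
   with zero boundary values is not onto; the bound is trivial there. *)
Definition uniform_resolvent_bound (L : diffop) (K theta1 : R) : Prop :=
  forall lambda : R[i], ~ wedge theta1 lambda -> lambda != 0 ->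
  forall f, in_Linf f ->
    exists u, [/\ resolvent_solution L lambda f u,
      forall v, resolvent_solution L lambda f v ->
        forall x, clOmega x -> v x = u x &
      (Linf_norm u <= K%:E * Linf_norm f)%E].

End FunctionSpaces.

Section PeriodicError.
Context {R : realType} {s : nat}.
Variables (A : 'M[R]_s) (b : 'cV[R]_s) (L : diffop (R := R)).
Variables (omega : R) (U : R -> R[i]).

(* U is the spatial part of the exact solution U(x) e^{i omega t}. *)
Definition periodic_exact_solution (fhat ghat : R -> R[i]) : Prop :=
  [/\ aeOmega (fun x => omega*i * U x - apply_op L U x = fhat x),
      U 0 = ghat 0 & U 1 = ghat 1].

(* The sums over j >= 1 are indexed by n = j - 1. *)
Definition delta_stage (dt : R) (x : R) : 'cV[R[i]]_s :=
  \col_k (U x * cseries (fun n =>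
    (omega*i) ^+ n.+1 * (dt%:C) ^+ n.+1 / n`!%:R *
    (stage_residual A n.+1 k 0)%:C)).

Definition delta_step (dt : R) (x : R) : R[i] :=
  U x * cseries (fun n =>
    (omega*i) ^+ n.+1 * (dt%:C) ^+ n.+1 / n`!%:R *
    ((b^T *m cvpow (abscissae A) n) 0 0 - n.+1%:R^-1)%:C).

Definition periodic_error (dt : R) (eps0 : R -> R[i])
    (eps : R -> 'cV[R[i]]_s) : Prop :=
  let z := expi (omega * dt) in
  let Leps x := \col_k apply_op L (fun y => eps y k 0) x in
  [/\ forall k, homogeneous_domain (fun x => eps x k 0),
      aeOmega (fun x =>
        eps x - (z^-1 * eps0 x) *: cmx ones - dt%:C *: (cmx A *m Leps x) =
        z^-1 *: delta_stage dt x) &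
      aeOmega (fun x =>
        (z - 1) * eps0 x =
        z * dt%:C * ((cmx b)^T *m Leps x) 0 0 + delta_step dt x)].

End PeriodicError.

(* Main.v *)
(** The stage residuals up to order [q] span, together with their images under
    [A], a space that [b] annihilates.  The part [V] of the stage error they
    produce, which solves [(I - dt A L) V = z^-1 U dV] with zero boundary values,
    therefore never reaches [eps0].  The remaining stage error [E] satisfies
    [(I - (dt/w) (e b^T + w A) L) E = O(dt^min(p,q+1))] with [w = z - 1].
    After diagonalizing, every component solves a resolvent equation for
    [lambda = dt mu / w], [mu] an eigenvalue of [e b^T + w A].  Such [mu] is
    nonzero since [b^T A^-1 e <> 0], and [R(w/mu) = z] has modulus 1; by the
    maximum principle [w/mu], hence [lambda], lies outside the wedge, and
    the resolvent bound gives [E = O(dt^min(p,q+1))].  Finally [eps0] is recovered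
    from [E] by applying [b^T A^-1] to the stage equation, again because
    [b^T A^-1 e <> 0]. *)
Require Import Defs.
From HB Require Import structures.
From mathcomp Require Import all_boot all_order all_algebra.
From mathcomp Require Import all_classical all_reals all_analysis.
From mathcomp Require Import measurable_realfun ess_sup_inf complex.
From mathcomp Require Import ring lra.

Set Implicit Arguments.
Unset Strict Implicit.
Unset Printing Implicit Defensive.

Import Order.TTheory GRing.Theory Num.Theory.
Import numFieldNormedType.Exports.
Local Open Scope classical_set_scope.
Local Open Scope ring_scope.
Local Open Scope complex_scope.
Local Notation cabs := Normc.normc.

(** * Modulus, real part and imaginary part of complex numbers *)

Section ComplexNorm.
Variable R : realType.
Implicit Types z w : R[i].

Lemma cabs_ge0 z : 0 <= cabs z.
Proof. by case: z => a b; rewrite sqrtr_ge0. Qed.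

Lemma cabs0 : cabs (0 : R[i]) = 0.
Proof. exact: Normc.normc0. Qed.

Lemma cabs1 : cabs (1 : R[i]) = 1.
Proof. exact: Normc.normc1. Qed.

Lemma cabs_eq0 z : (cabs z == 0) = (z == 0).
Proof.
by apply/eqP/eqP => [/Normc.eq0_normc//|->]; exact: cabs0.
Qed.

Lemma cabs_gt0 z : (0 < cabs z) = (z != 0).
Proof. by rewrite lt_def cabs_eq0 cabs_ge0 andbT. Qed.

Lemma cabsX z n : cabs (z ^+ n) = cabs z ^+ n.
Proof.
elim: n => [|n IH]; first by rewrite !expr0 cabs1.
by rewrite !exprS Normc.normcM IH.
Qed.

Lemma cabs_real (x : R) : cabs x%:C = `|x|.
Proof. by rewrite /= expr0n /= addr0 sqrtr_sqr. Qed.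

Lemma cabsB z w : cabs (z - w) <= cabs z + cabs w.
Proof. by rewrite -(normcN w) le_normcD. Qed.

Lemma cabs_subC z w : cabs (z - w) = cabs (w - z).
Proof. by rewrite -normcN opprB. Qed.

Lemma cabs_triangle z w : cabs z - cabs w <= cabs (z - w).
Proof. by rewrite lerBlDr (le_trans _ (le_normcD _ _))// subrK. Qed.

Lemma cabs_sum (I : Type) (r : seq I) (P : pred I) (F : I -> R[i]) :
  cabs (\sum_(i <- r | P i) F i) <= \sum_(i <- r | P i) cabs (F i).
Proof.
elim/big_ind2: _ => //; first by rewrite cabs0.
by move=> a x b y ha hb; rewrite (le_trans (le_normcD _ _))// lerD.
Qed.

Lemma ReN z : complex.Re (- z) = - complex.Re z.
Proof. by case: z. Qed.

Lemma ImN z : complex.Im (- z) = - complex.Im z.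
Proof. by case: z. Qed.

Lemma ReD z w : complex.Re (z + w) = complex.Re z + complex.Re w.
Proof. by case: z w => ? ? []. Qed.

Lemma ImD z w : complex.Im (z + w) = complex.Im z + complex.Im w.
Proof. by case: z w => ? ? []. Qed.

Lemma ReM z w : complex.Re (z * w) =
  complex.Re z * complex.Re w - complex.Im z * complex.Im w.
Proof. by case: z w => ? ? []. Qed.

Lemma ImM z w : complex.Im (z * w) =
  complex.Re z * complex.Im w + complex.Im z * complex.Re w.
Proof. by case: z w => ? ? []. Qed.

Lemma Re_le_cabs z : `|complex.Re z| <= cabs z.
Proof. by case: z => a b /=; rewrite -sqrtr_sqr ler_sqrt ?addr_ge0 ?sqr_ge0// lerDl sqr_ge0. Qed.

Lemma Im_le_cabs z : `|complex.Im z| <= cabs z.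
Proof. by case: z => a b /=; rewrite -sqrtr_sqr ler_sqrt ?addr_ge0 ?sqr_ge0// lerDr sqr_ge0. Qed.

Lemma cabs_le_ReIm z : cabs z <= `|complex.Re z| + `|complex.Im z|.
Proof.
rewrite [X in cabs X]complexE (le_trans (le_normcD _ _))//.
rewrite Normc.normcM !cabs_real [cabs (Complex _ _)](_ : _ = 1) ?mul1r//.
by rewrite /= expr0n expr1n /= add0r sqrtr1.
Qed.

Lemma cabs_expi (t : R) : cabs (expi t) = 1.
Proof. by rewrite /= cos2Dsin2 sqrtr1. Qed.

End ComplexNorm.

(** * Geometry of the wedge *)

Section Wedge.
Variable R : realType.
Implicit Types z w : R[i].

Lemma Re_div_cabs z : -1 <= complex.Re z / cabs z <= 1.
Proof.
have [->|z0] := eqVneq z 0; first by rewrite /= mul0r; lra.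
rewrite -ler_norml normrM normfV (ger0_norm (cabs_ge0 z)).
by rewrite ler_pdivrMr ?cabs_gt0// mul1r Re_le_cabs.
Qed.

(** Up to sign [carg] is an arccosine, and cosine decreases on [0, pi]. The angular condition thus
    becomes an inequality between real part and modulus, on which inversion, scaling and openness
    are easy to check. *)
Lemma wedgeE (theta : R) z : 0 < theta <= pi / 2 ->
  wedge theta z <-> z != 0 /\ cos theta * cabs z < - complex.Re z.
Proof.
move=> /andP[t0 tpi]; have pi0 := pi_gt0 R.
have h2 : -1 <= - complex.Re z / cabs z <= 1.
  by rewrite -ReN -(normcN z) Re_div_cabs.
have aux : `|carg (- z)| = acos (- complex.Re z / cabs z).
  rewrite /carg normcN ReN; have h : 0 <= acos (- complex.Re z / cabs z).
    by rewrite acos_ge0.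
  by case: ifP => _; rewrite ?normrN ger0_norm.
have hth : theta \in `[0, pi]%R by rewrite in_itv /=; lra.
have hac : acos (- complex.Re z / cabs z) \in `[0, pi]%R.
  by rewrite in_itv /= acos_ge0 ?acos_lepi.
have E : z != 0 -> (`|carg (- z)| < theta) = (cos theta * cabs z < - complex.Re z).
  move=> z0; rewrite aux -[RHS]ltr_pdivlMr ?cabs_gt0//.
  by rewrite -[X in _ = (_ < X)]acosK ?in_itv// ltr_cos.
by rewrite /wedge /=; split => -[z0]; rewrite E.
Qed.

Lemma wedge_subset (t1 t2 : R) z : t1 <= t2 -> wedge t1 z -> wedge t2 z.
Proof. by move=> t12 [z0 h]; split=> //; apply: lt_le_trans h t12. Qed.

Lemma ReV z : complex.Re z^-1 = complex.Re z / cabs z ^+ 2.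
Proof.
by case: z => a b /=; rewrite sqr_sqrtr ?addr_ge0 ?sqr_ge0.
Qed.

Lemma wedgeV (theta : R) z : 0 < theta <= pi / 2 ->
  wedge theta z -> wedge theta z^-1.
Proof.
move=> ht; rewrite !wedgeE// => -[z0 h]; split; first by rewrite invr_eq0.
have c0 : 0 < cabs z by rewrite cabs_gt0.
rewrite Normc.normcV ReV -mulNr ltr_pdivlMr ?exprn_gt0//.
by rewrite expr2 !mulrA divfK// gt_eqF.
Qed.

Lemma wedge_scale (theta : R) (r : R) z : 0 < theta <= pi / 2 -> 0 < r ->
  wedge theta (r%:C * z) -> wedge theta z.
Proof.
move=> ht r0; rewrite !wedgeE// => -[]; rewrite mulf_eq0 negb_or => /andP[_ z0].
rewrite Normc.normcM cabs_real gtr0_norm// => h; split=> //.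
move: h; have -> : complex.Re (r%:C * z) = r * complex.Re z.
  by rewrite ReM /= mul0r subr0.
by rewrite mulrCA -mulrN ltr_pM2l.
Qed.

Lemma not_wedge_Re_ge0 (theta : R) z : 0 < theta <= pi / 2 ->
  0 <= complex.Re z -> ~ wedge theta z.
Proof.
move=> ht hz; rewrite wedgeE// => -[z0].
have : 0 <= cos theta * cabs z.
  rewrite mulr_ge0 ?cabs_ge0// cos_ge0_pihalf//.
  by have := pi_gt0 R; lra.
by lra.
Qed.

Lemma wedge_open (theta : R) z : 0 < theta <= pi / 2 -> wedge theta z ->
  exists2 r : R, 0 < r & forall h, cabs h < r -> wedge theta (z + h).
Proof.
move=> ht; rewrite wedgeE// => -[z0 h].
have c0 : 0 <= cos theta.
  by apply: cos_ge0_pihalf; have := pi_gt0 R; lra.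
have c1 := cos_le1 theta.
(* Half the slack in the inequality: since cos theta <= 1, a perturbation [d] moves each side by at
   most its modulus. *)
exists ((- complex.Re z - cos theta * cabs z) / 2); first by lra.
move=> d hd; rewrite wedgeE//.
have hn : cabs (z + d) <= cabs z + cabs d := le_normcD _ _.
have := Re_le_cabs d; rewrite ler_norml => /andP[_ hd1].
have H : cos theta * cabs (z + d) < - complex.Re (z + d).
  rewrite ReD.
  have := ler_wpM2l c0 hn; rewrite mulrDr.
  have := ler_wpM2r (cabs_ge0 d) c1; lra.
split=> //; apply/eqP => zd0; move: H; rewrite zd0 cabs0 /= mulr0 oppr0; lra.
Qed.

End Wedge.

(** * A local maximum principle for rational functions *)

Section MaximumPrinciple.
Variable R : realType.
Implicit Types (z w x h : R[i]) (p N D : {poly R[i]}).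

Lemma poly_locally_lipschitz p x :
  exists2 M : R, 0 <= M &
    forall h, cabs h <= 1 -> cabs (p.[x + h] - p.[x]) <= M * cabs h.
Proof.
elim/poly_ind: p => [|p c [M M0 IH]].
  by exists 0 => // h _; rewrite !horner0 subrr cabs0 mul0r.
exists (M * (cabs x + 1) + cabs p.[x]).
  by rewrite addr_ge0 ?mulr_ge0 ?addr_ge0 ?cabs_ge0.
move=> h h1; rewrite !hornerMXaddC.
have -> : p.[x + h] * (x + h) + c - (p.[x] * x + c) =
  (p.[x + h] - p.[x]) * (x + h) + p.[x] * h by ring.
rewrite (le_trans (le_normcD _ _))// !Normc.normcM [leRHS]mulrDl lerD2r.
rewrite [leRHS]mulrAC ler_pM ?cabs_ge0 ?IH//.
by rewrite (le_trans (le_normcD _ _))// lerD2l.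
Qed.

Lemma poly_continuous_at p x (e : R) : 0 < e ->
  exists2 r : R, 0 < r & forall h, cabs h < r -> cabs (p.[x + h] - p.[x]) <= e.
Proof.
move=> e0; have [M M0 HM] := poly_locally_lipschitz p x.
exists (Num.min 1 (e / (M + 1))); first by rewrite lt_min ltr01 divr_gt0// ltr_wpDl.
move=> h; rewrite lt_min => /andP[h1]; rewrite ltr_pdivlMr ?ltr_wpDl// => h2.
rewrite (le_trans (HM _ (ltW h1)))//.
by have := cabs_ge0 h; nra.
Qed.

Lemma poly_ratio_close p x (e : R) : 0 < e -> p.[x] != 0 ->
  exists2 r : R, 0 < r &
    forall h, cabs h < r -> cabs (p.[x + h] / p.[x] - 1) <= e.
Proof.
move=> e0 px; have px0 : 0 < cabs p.[x] by rewrite cabs_gt0.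
have [r r0 Hr] := poly_continuous_at p x (mulr_gt0 e0 px0).
exists r => // h /Hr; have -> : p.[x + h] / p.[x] - 1 = (p.[x + h] - p.[x]) / p.[x].
  by rewrite mulrBl divff.
by rewrite Normc.normcM Normc.normcV ler_pdivrMr.
Qed.

(* Near a zero [x] of order [k], [N/D] behaves like [a h^k]; along the
   direction in which [a h^k] is a positive multiple of [z] the modulus
   increases. *)
Lemma unimodular_value_exceeded N D x z (r : R) :
  N != 0 -> N.[x] = 0 -> D.[x] != 0 -> cabs z = 1 -> 0 < r ->
  exists h, [/\ cabs h < r, D.[x + h] != 0 &
    1 < cabs (z + N.[x + h] / D.[x + h])].
Proof.
move=> N0 Nx Dx z1 r0.
have z0 : z != 0 by rewrite -cabs_gt0 z1.
have [k [N1 N1x defN]] := multiplicity_XsubC N x.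
rewrite N0 /= /root in N1x.
case: k defN => [|k] defN.
  by move: N1x; rewrite -[N1]mulr1 -(expr0 ('X - x%:P)) -defN Nx eqxx.
(* With [u] and [v] within 1/4 of 1, |v| >= 3/4 and |u - v| <= 1/2. Hence |u/v - 1| <= 2/3, so
   [u / v] has positive real part and cannot undo the increase of the modulus. *)
have [rN rN0 HN] := poly_ratio_close (ltac:(lra) : 0 < (4^-1 : R)) N1x.
have [rD rD0 HD] := poly_ratio_close (ltac:(lra) : 0 < (4^-1 : R)) Dx.
pose a := N1.[x] / D.[x].
have a0 : a != 0 by rewrite mulf_neq0 ?invr_neq0.
(* The direction of increase: the leading term a (t eta)^(k+1) equals t^(k+1) z. *)
pose eta := k.+1.-root (z / a).
have etaK : eta ^+ k.+1 = z / a by rewrite rootCK.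
have eta0 : 0 < cabs eta.
  rewrite cabs_gt0; apply: contraTneq z0 => e0.
  by move: etaK; rewrite e0 expr0n /= => /esym/eqP; rewrite mulf_eq0 invr_eq0 (negPf a0) orbF negbK.
pose t := Num.min r (Num.min rN rD) / (2 * cabs eta).
have t0 : 0 < t by rewrite divr_gt0 ?mulr_gt0// !lt_min r0 rN0.
pose h := t%:C * eta.
have habs : cabs h = Num.min r (Num.min rN rD) / 2.
  by rewrite Normc.normcM cabs_real gtr0_norm// /t invfM mulrA divfK// gt_eqF.
have hm : cabs h < Num.min r (Num.min rN rD).
  have : 0 < Num.min r (Num.min rN rD) by rewrite !lt_min r0 rN0.
  by rewrite habs; lra.
have := hm; rewrite !lt_min => /and3P[hr hN hD].
have := HN _ hN; have := HD _ hD.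
set u := N1.[x + h] / N1.[x]; set v := D.[x + h] / D.[x] => hv hu.
have v34 : 3 / 4 <= cabs v.
  by have := cabs_triangle 1 (1 - v); rewrite subKr cabs1 [cabs (1 - v)]cabs_subC; lra.
have v0 : v != 0 by rewrite -cabs_gt0; lra.
have Dh0 : D.[x + h] != 0 by apply: contraNneq v0 => e; rewrite /v e mul0r.
exists h; split=> //.
have -> : N.[x + h] / D.[x + h] = z * ((t ^+ k.+1)%:C * (u / v)).
  rewrite defN hornerM horner_exp hornerXsubC addrAC subrr add0r.
  rewrite exprMn -rmorphXn etaK /u /v /a.
  by field; rewrite Dh0 Dx N1x.
rewrite -{1}[z]mulr1 -mulrDr Normc.normcM z1 mul1r.
apply: lt_le_trans (le_trans (ler_norm _) (Re_le_cabs _)).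
rewrite ReD /= [ltRHS](_ : _ = 1 + t ^+ k.+1 * complex.Re (u / v)); last first.
  by rewrite ReM /= mul0r subr0.
rewrite ltrDl mulr_gt0 ?exprn_gt0//.
have -> : u / v = 1 + (u - v) / v by field.
have := Re_le_cabs ((u - v) / v); rewrite ReD /= ler_norml => /andP[+ _].
suff : cabs ((u - v) / v) <= 2 / 3 by lra.
rewrite Normc.normcM Normc.normcV ler_pdivrMr; last by lra.
have := cabsB (u - 1) (v - 1); have -> : u - 1 - (v - 1) = u - v by ring.
lra.
Qed.

End MaximumPrinciple.

(** * The stability function and the spectrum of the stage matrix *)

Section StabilityFunction.
Variables (R : realType) (s : nat) (A : 'M[R]_s) (b : 'cV[R]_s).
Implicit Types (z w zeta mu : R[i]).

(** Cramer's rule for the polynomial matrix I - X A: [D] is its determinant and [N] is X b^T adj(I -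
    X A) e. *)
Lemma stability_function_rational :
  exists N D : {poly R[i]}, [/\ N.[0] = 0, D.[0] = 1,
    forall zeta, (1%:M - zeta *: cmx A \in unitmx) = (D.[zeta] != 0) &
    forall zeta, D.[zeta] != 0 ->
      stability_function A b zeta = 1 + N.[zeta] / D.[zeta]].
Proof.
pose P : 'M[{poly R[i]}]_s := 1%:M - 'X *: map_mx polyC (cmx A).
have hP zeta : map_mx (horner_eval zeta) P = 1%:M - zeta *: cmx A.
  rewrite /P map_mxB map_mx1 map_mxZ /= /horner_eval hornerX -map_mx_comp.
  by congr (_ - _ *: _); apply/matrixP => i j; rewrite !mxE /= /horner_eval hornerC.
pose D := \det P.
have hD zeta : D.[zeta] = \det (1%:M - zeta *: cmx A).
  by rewrite -hP det_map_mx.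
pose N := 'X * ((map_mx polyC (cmx b))^T *m \adj P *m map_mx polyC (cmx ones)) 0 0.
have hN zeta : N.[zeta] =
    zeta * ((cmx b)^T *m \adj (1%:M - zeta *: cmx A) *m cmx ones) 0 0.
  rewrite hornerM hornerX; congr (_ * _).
  have hC m n (B : 'M[R[i]]_(m, n)) : map_mx (horner_eval zeta) (map_mx polyC B) = B.
    by apply/matrixP => i j; rewrite !mxE /= /horner_eval hornerC.
  rewrite -hP -map_mx_adj -[LHS]/(horner_eval zeta _).
  transitivity ((map_mx (horner_eval zeta)
    ((map_mx polyC (cmx b))^T *m \adj P *m map_mx polyC (cmx ones))) 0 0).
    by rewrite [RHS]mxE.
  by rewrite !map_mxM /= -map_trmx !hC.
exists N, D; split.
- by rewrite hN mul0r.
- by rewrite hD scale0r subr0 det1.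
- by move=> zeta; rewrite unitmxE hD unitfE.
- move=> zeta Dz; rewrite /stability_function hN hD.
  have hu : 1%:M - zeta *: cmx A \in unitmx by rewrite unitmxE -hD unitfE.
  rewrite /invmx hu -scalemxAr -scalemxAl mxE.
  by congr (_ + _); rewrite [RHS]mulrAC -mulrA.
Qed.

(** If R(zeta) = z, then N - (z - 1) D vanishes at zeta but not at 0, where it equals 1 - z. By the
    maximum principle |R| > 1 at points arbitrarily close to zeta. These still lie in the open
    wedge, against stability. *)
Lemma unimodular_value_outside_wedge (theta : R) zeta z :
  0 < theta <= pi / 2 -> wedge theta `<=` stability_region A b ->
  cabs z = 1 -> z != 1 -> wedge theta zeta ->
  stability_function A b zeta != z.
Proof.
move=> ht hb z1 zn1 hz; apply/eqP => Rz.
have [N [D [N0 D0 hu hR]]] := stability_function_rational.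
have [r r0 hr] := wedge_open ht hz.
have Dz : D.[zeta] != 0 by rewrite -hu; case: (hb _ hz).
pose N1 := N - (z - 1) *: D.
have N1z : N1.[zeta] = 0.
  rewrite !hornerE -Rz hR//; by field.
have N10 : N1 != 0.
  apply: contraNneq zn1 => e; have : N1.[0] = 0 by rewrite e horner0.
  by rewrite !hornerE N0 D0 mulr1 sub0r => /eqP; rewrite oppr_eq0 subr_eq0.
have [h [hh Dh]] := unimodular_value_exceeded N10 N1z Dz z1 r0.
have -> : z + N1.[zeta + h] / D.[zeta + h] = stability_function A b (zeta + h).
  by rewrite hR// /N1 !hornerE; field.
by rewrite ltNge; have [_ ->] := hb _ (hr _ hh).
Qed.

Hypothesis unitA : A \in unitmx.

Lemma cmx_unit : cmx A \in unitmx.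
Proof. by rewrite /cmx map_unitmx. Qed.

Let beta := (b^T *m invmx A *m ones) 0 0.

Lemma beta_cmx : ((cmx b)^T *m invmx (cmx A) *m cmx ones) 0 0 = beta%:C.
Proof.
by rewrite /cmx -map_invmx map_trmx -!map_mxM mxE.
Qed.

(** Left eigenvectors are used because they are the rows of the inverse of an eigenvector matrix.
    With [le] = l e the eigenvalue equation reads le b^T + w l A = mu l. *)
Lemma stage_eigenvalue (theta : R) (l : 'rV[R[i]]_s) w mu :
  0 < theta <= pi / 2 -> wedge theta `<=` stability_region A b ->
  w != 0 -> w + beta%:C != 0 -> cabs (1 + w) = 1 -> l != 0 ->
  l *m (cmx ones *m (cmx b)^T + w *: cmx A) = mu *: l ->
  mu != 0 /\ ~ wedge theta (mu / w).
Proof.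
move=> ht hb w0 wb w1 l0 El.
pose le := (l *m cmx ones) 0 0.
have E1 : le *: (cmx b)^T + w *: (l *m cmx A) = mu *: l.
  rewrite -El mulmxDr -scalemxAr mulmxA; congr (_ + _).
  by rewrite [l *m cmx ones]mx11_scalar mul_scalar_mx.
have mu0 : mu != 0.
  (* For mu = 0, multiplying by A^-1 and then by e gives (w + beta) le = 0. Hence le = 0, which
     leaves w l = 0. *)
  apply/eqP => m0; move: E1; rewrite m0 scale0r.
  move/(congr1 (mulmx^~ (invmx (cmx A)))); rewrite mulmxDl mul0mx -!scalemxAl.
  rewrite mulmxK ?cmx_unit// => E2.
  have : (w + beta%:C) * le = 0.
    have := congr1 (fun v : 'rV_s => (v *m cmx ones) 0 0) E2.
    rewrite /= mulmxDl mul0mx -!scalemxAl [LHS]mxE [X in X + _]mxE.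
    by rewrite [X in _ + X]mxE beta_cmx -/le [RHS]mxE => <-; ring.
  move/eqP; rewrite mulf_eq0 (negPf wb) /= => /eqP le0; move/eqP: E2.
  by rewrite le0 scale0r add0r scaler_eq0 (negPf w0) (negPf l0).
split=> //; move=> /(wedgeV ht); rewrite invf_div; set zeta := w / mu => hz.
have [hu _] := hb _ hz.
(* If zeta = w/mu were in the wedge, I - zeta A would be invertible. Solving for [l] and applying
   the result to e then gives b^T (I - zeta A)^-1 e = mu, that is R(zeta) = 1 + w, a value of
   modulus 1 other than 1. *)
have E3 : l *m (1%:M - zeta *: cmx A) = (le / mu) *: (cmx b)^T.
  have E2 : l = mu^-1 *: (le *: (cmx b)^T + w *: (l *m cmx A)).
    by rewrite E1 scalerA mulVf// scale1r.
  rewrite mulmxBr mulmx1 -scalemxAr [X in X - _]E2 scalerDr !scalerA.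
  by rewrite [mu^-1 * w]mulrC [mu^-1 * le]mulrC addrK.
have E4 : l = (le / mu) *: ((cmx b)^T *m invmx (1%:M - zeta *: cmx A)).
  by rewrite scalemxAl -E3 mulmxK.
have le0 : le != 0 by apply: contraNneq l0 => e; rewrite E4 e mul0r scale0r.
have := @unimodular_value_outside_wedge theta zeta (1 + w) ht hb w1 _ hz.
rewrite -subr_eq0 [1 + w]addrC addrK => /(_ w0)/eqP; apply.
rewrite /stability_function addrC; congr (_ + _).
have : le = le / mu * ((cmx b)^T *m invmx (1%:M - zeta *: cmx A) *m cmx ones) 0 0.
  by rewrite {1}/le E4 -scalemxAl mxE.
set x := (_ *m _ *m _) 0 0 => E5.
have : x = mu by apply: (mulfI le0); rewrite {2}E5; field.
by move=> ->; rewrite /zeta divfK.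
Qed.

End StabilityFunction.

(** * Linearity of derivatives of complex-valued functions *)

Section ComplexDerivative.
Variable R : realType.
Implicit Types (f g h : R -> R) (u v : R -> R[i]) (a : R[i]) (x : R).

Lemma is_derive_comb (r t : R) f g h x :
  derivable f x 1 -> derivable g x 1 -> derivable h x 1 ->
  is_derive x 1 (fun y => r * f y + t * g y + h y)
    (r * derive1 f x + t * derive1 g x + derive1 h x).
Proof.
move=> /derivableP df /derivableP dg /derivableP dh; rewrite !derive1E.
exact: is_deriveD (is_deriveD (is_deriveZ r df) (is_deriveZ t dg)) dh.
Qed.

Lemma continuous_within_comb (B : set R) (r t : R) f g h :
  {within B, continuous f} -> {within B, continuous g} ->
  {within B, continuous h} ->
  {within B, continuous (fun y => r * f y + t * g y + h y)}.
Proof.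
move=> cf cg ch x; apply: cvgD (ch x).
by apply: cvgD; [apply: cvgM (cvg_cst _) (cf x)|apply: cvgM (cvg_cst _) (cg x)].
Qed.

Lemma Re_lin a u v :
  (fun y => complex.Re (a * u y + v y)) = (fun y => complex.Re a * complex.Re (u y)
    + - complex.Im a * complex.Im (u y) + complex.Re (v y)).
Proof. by apply/funext => y; rewrite ReD ReM mulNr. Qed.

Lemma Im_lin a u v :
  (fun y => complex.Im (a * u y + v y)) = (fun y => complex.Re a * complex.Im (u y)
    + complex.Im a * complex.Re (u y) + complex.Im (v y)).
Proof. by apply/funext => y; rewrite ImD ImM. Qed.

Lemma cderivable_lin a u v x : cderivable u x -> cderivable v x ->
  cderivable (fun y => a * u y + v y) x /\
  cderive (fun y => a * u y + v y) x = a * cderive u x + cderive v x.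
Proof.
move=> [ur ui] [vr vi]; rewrite /cderivable /cderive Re_lin Im_lin.
have [dr er] := is_derive_comb (complex.Re a) (- complex.Im a) ur ui vr.
have [di ei] := is_derive_comb (complex.Re a) (complex.Im a) ui ur vi.
split; first exact: conj dr di.
rewrite !derive1E er ei -!derive1E.
by apply/eqP; rewrite eq_complex ReD ImD ReM ImM /= mulNr !eqxx.
Qed.

Lemma near_cderive u v x : {near x, u =1 v} -> cderivable u x ->
  cderivable v x /\ cderive u x = cderive v x.
Proof.
move=> uv [ur ui]; rewrite /cderivable /cderive !derive1E.
have hr : {near x, (fun y => complex.Re (u y)) =1 (fun y => complex.Re (v y))}.
  by apply: filterS uv => y ->.
have hi : {near x, (fun y => complex.Im (u y)) =1 (fun y => complex.Im (v y))}.
  by apply: filterS uv => y ->.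
split; last by congr Complex; apply: near_eq_derive.
by split; [apply: near_eq_derivable hr ur|apply: near_eq_derivable hi ui].
Qed.

Lemma near_Omega x : Omega x -> \forall y \near x, Omega y.
Proof.
move=> Ox; have -> : Omega = `]0 : R, 1[%classic by rewrite set_itvoo.
by apply: open_nbhs_nbhs; split; [exact: interval_open|rewrite /= in_itv].
Qed.

Lemma cderive_cst a x : cderivable (fun=> a) x /\ cderive (fun=> a) x = 0.
Proof.
by split; [split; exact: derivable_cst|rewrite /cderive !derive1_cst].
Qed.

(** Differentiating a second time requires the first-order identity in a neighbourhood of x, which
    is available because Omega is open. *)
Lemma cderive2_lin a u v x : Omega x ->
  (forall y, Omega y -> cderivable u y) -> (forall y, Omega y -> cderivable v y) ->
  cderivable (cderive u) x -> cderivable (cderive v) x ->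
  cderivable (cderive (fun y => a * u y + v y)) x /\
  cderive (cderive (fun y => a * u y + v y)) x =
    a * cderive (cderive u) x + cderive (cderive v) x.
Proof.
move=> Ox du dv du2 dv2.
have hn : {near x, (fun y => a * cderive u y + cderive v y) =1
                   cderive (fun y => a * u y + v y)}.
  apply: filterS (near_Omega Ox) => y Oy.
  by have [_ ->] := cderivable_lin a (du _ Oy) (dv _ Oy).
have [dw <-] := cderivable_lin a du2 dv2.
by have [? ->] := near_cderive hn dw.
Qed.

End ComplexDerivative.

(** * Essentially bounded functions and the domain of the operator *)

Section FunctionSpaces.
Variable R : realType.
Implicit Types (f g : R -> R) (u v : R -> R[i]) (a : R[i]) (P Q : R -> Prop).

Let ae_filter : Filter (almost_everywhere (@lebesgue_measure R)).
Proof. exact: ae_filter_ringOfSetsType. Qed.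

Lemma aeOmega_all P : (forall x, Omega x -> P x) -> aeOmega P.
Proof. by move=> h; apply: aeW => x; exact: h. Qed.

Lemma aeOmegaS P Q : (forall x, Omega x -> P x -> Q x) -> aeOmega P -> aeOmega Q.
Proof.
by move=> PQ; apply: (@filterS _ _ ae_filter) => x Px Ox; exact: PQ (Px Ox).
Qed.

Lemma aeOmegaI P Q : aeOmega P -> aeOmega Q -> aeOmega (fun x => P x /\ Q x).
Proof.
apply: (@filterS2 _ _ ae_filter) => x Px Qx Ox.
by split; [exact: Px|exact: Qx].
Qed.

Lemma aeOmega_forall (I : finType) (P : I -> R -> Prop) :
  (forall i, aeOmega (P i)) -> aeOmega (fun x => forall i, P i x).
Proof.
move=> /(filter_forall ae_filter); apply: (@filterS _ _ ae_filter) => x h Ox i.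
exact: h.
Qed.

(** The sign of [M] matters: the norm is taken of the extension by 0 outside Omega, so it can be
    bounded only by a nonnegative number. *)
Lemma Linf_norm_le u (M : R) : 0 <= M ->
  (Linf_norm u <= M%:E)%E <-> aeOmega (fun x => cabs (u x) <= M).
Proof.
move=> M0; split.
  move=> /ess_supP; apply: (@filterS _ _ ae_filter) => x; rewrite /= lee_fin patchE => + Ox.
  by rewrite mem_set.
move=> h; apply/ess_supP; apply: (@filterS _ _ ae_filter) h => x h.
rewrite /= lee_fin patchE; case: ifPn => // /set_mem; exact: h.
Qed.

Lemma in_LinfP u : in_Linf u <->
  [/\ measurable_fun Omega (fun x => complex.Re (u x)),
      measurable_fun Omega (fun x => complex.Im (u x)) &
      exists M : R, aeOmega (fun x => cabs (u x) <= M)].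
Proof.
split=> -[mr mi h]; split=> //.
  have [l0|l0] := leP (Linf_norm u) 0%:E.
    by exists 0; apply/Linf_norm_le.
  have fin : Linf_norm u \is a fin_num by rewrite ge0_fin_numE// ltW.
  exists (fine (Linf_norm u)); apply/Linf_norm_le; last by rewrite fineK.
  by rewrite fine_ge0// ltW.
have [M hM] := h; apply: (@le_lt_trans _ _ (Num.max 0 M)%:E); last exact: ltry.
apply/Linf_norm_le; first by rewrite le_max lexx.
by apply: aeOmegaS hM => x _ hx; rewrite le_max hx orbT.
Qed.

Lemma clOmegaE : clOmega = `[0 : R, 1]%classic.
Proof. by rewrite set_itvcc. Qed.

Lemma Omega_clOmega (x : R) : Omega x -> clOmega x.
Proof. by move=> /andP[x0 x1]; rewrite /clOmega/= !ltW. Qed.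

Lemma within_clOmega_measurable f :
  {within clOmega, continuous f} -> measurable_fun Omega f.
Proof.
move=> cf; have mO : measurable (Omega : set R).
  have -> : Omega = `]0 : R, 1[%classic by rewrite set_itvoo.
  exact: measurable_itv.
apply: subspace_continuous_measurable_fun => //.
by apply: continuous_subspaceW cf; exact: Omega_clOmega.
Qed.

Lemma within_clOmega_bounded f : {within clOmega, continuous f} ->
  exists M : R, forall x, clOmega x -> `|f x| <= M.
Proof.
rewrite clOmegaE => cf.
have [c _ hc] := EVT_max (@ler01 R) cf; have [d _ hd] := EVT_min (@ler01 R) cf.
exists (Num.max `|f c| `|f d|) => x xI.
have h1 := hc _ xI; have h2 := hd _ xI.
have h3 : `|f c| <= Num.max `|f c| `|f d| by rewrite le_max lexx.
have h4 : `|f d| <= Num.max `|f c| `|f d| by rewrite le_max lexx orbT.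
have := ler_norm (f c); have := ler_norm (- f d); rewrite normrN => h5 h6.
by rewrite ler_norml; lra.
Qed.

Definition ccontinuous u := {within clOmega, continuous (fun x => complex.Re (u x))} /\
      {within clOmega, continuous (fun x => complex.Im (u x))}.

Lemma ccontinuous_bounded u : ccontinuous u ->
  exists M : R, forall x, clOmega x -> cabs (u x) <= M.
Proof.
move=> [/within_clOmega_bounded[M hM] /within_clOmega_bounded[N hN]].
exists (M + N) => x Ox; apply: le_trans (cabs_le_ReIm _) _.
by rewrite lerD ?hM ?hN.
Qed.

Lemma ccontinuous_in_Linf u : ccontinuous u -> in_Linf u.
Proof.
move=> cu; apply/in_LinfP; split.
- by apply: within_clOmega_measurable; case: cu.
- by apply: within_clOmega_measurable; case: cu.
- have [M hM] := ccontinuous_bounded cu; exists M.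
  by apply: aeOmega_all => x /Omega_clOmega; exact: hM.
Qed.

Lemma C2_closed_ccontinuous u : C2_closed u -> ccontinuous u.
Proof.
move=> [v [uv hv]].
have hE x : x \in (clOmega : set R) -> v x = u x.
  by move=> /set_mem xO; rewrite uv.
have cv : (continuous (fun x => complex.Re (v x)) /\
           continuous (fun x => complex.Im (v x))).
  split=> x; apply: differentiable_continuous; apply/derivable1_diffP.
    by case: (hv x) => -[dr _] _ _ _; exact: dr.
  by case: (hv x) => -[_ di] _ _ _; exact: di.
by split; [apply: (subspace_eq_continuous (f := fun x => complex.Re (v x)))
  |apply: (subspace_eq_continuous (f := fun x => complex.Im (v x)))];
  try (by move=> x xO; rewrite hE); apply: continuous_subspaceT; case: cv.
Qed.

Lemma in_Linf_lin a u v : in_Linf u -> in_Linf v ->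
  in_Linf (fun x => a * u x + v x).
Proof.
move=> /in_LinfP[ur ui [M hM]] /in_LinfP[vr vi [N hN]]; apply/in_LinfP.
rewrite Re_lin Im_lin; split.
- by do !apply: measurable_funD => //; apply: measurable_funM => //; exact: measurable_cst.
- by do !apply: measurable_funD => //; apply: measurable_funM => //; exact: measurable_cst.
- exists (cabs a * M + N); apply: aeOmegaS (aeOmegaI hM hN) => x _ [h1 h2].
  rewrite (le_trans (le_normcD _ _))// lerD// Normc.normcM.
  by rewrite ler_wpM2l ?cabs_ge0.
Qed.

Lemma in_Linf0 : in_Linf (fun=> 0 : R[i]).
Proof.
apply/in_LinfP; split; [exact: measurable_cst|exact: measurable_cst|].
by exists 0; apply: aeOmega_all => x _; rewrite cabs0.
Qed.

Lemma homogeneous_domain_ccontinuous u : homogeneous_domain u -> ccontinuous u.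
Proof. by move=> [[]]. Qed.

Lemma homogeneous_domain_lin a u v :
  homogeneous_domain u -> homogeneous_domain v ->
  homogeneous_domain (fun x => a * u x + v x).
Proof.
move=> [[[ur ui] du [k uk] du2] u0 u1] [[[vr vi] dv [m vm] dv2] v0 v1].
split; last 2 first.
- by rewrite u0 v0 mulr0 addr0.
- by rewrite u1 v1 mulr0 addr0.
split.
- by rewrite Re_lin Im_lin; split; exact: continuous_within_comb.
- by move=> x Ox; have [] := cderivable_lin a (du _ Ox) (dv _ Ox).
- exists (cabs a * k + m) => x y Ox Oy.
  have [_ ->] := cderivable_lin a (du _ Ox) (dv _ Ox).
  have [_ ->] := cderivable_lin a (du _ Oy) (dv _ Oy).
  rewrite (_ : _ - _ = a * (cderive u x - cderive u y) + (cderive v x - cderive v y));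
    last by ring.
  rewrite (le_trans (le_normcD _ _))// mulrDl lerD ?vm// Normc.normcM -mulrA.
  by rewrite ler_wpM2l ?cabs_ge0 ?uk.
- apply: aeOmegaS (aeOmegaI du2 dv2) => x Ox [h1 h2].
  by have [] := cderive2_lin a Ox du dv h1 h2.
Qed.

Lemma homogeneous_domain0 : homogeneous_domain (fun=> 0 : R[i]).
Proof.
have E : cderive (fun=> 0 : R[i]) = fun=> 0.
  by apply/funext => x; have [] := cderive_cst (0 : R[i]) x.
split=> //; split.
- by split; apply: continuous_subspaceT => x; exact: cvg_cst.
- by move=> x _; have [] := cderive_cst (0 : R[i]) x.
- by exists 0 => x y _ _; rewrite E subrr cabs0 mul0r.
- by apply: aeOmega_all => x _; rewrite E; have [] := cderive_cst (0 : R[i]) x.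
Qed.

Variable L : diffop (R := R).

Lemma apply_op0 (x : R) : apply_op L (fun=> 0) x = 0.
Proof.
have E : cderive (fun=> 0 : R[i]) = fun=> 0.
  by apply/funext => y; have [] := cderive_cst (0 : R[i]) y.
by rewrite /apply_op !E !mulr0 !addr0.
Qed.

(** Only an almost everywhere identity, since functions in the domain have second derivatives only
    almost everywhere. *)
Lemma apply_op_lin a u v : homogeneous_domain u -> homogeneous_domain v ->
  aeOmega (fun x => apply_op L (fun y => a * u y + v y) x =
                    a * apply_op L u x + apply_op L v x).
Proof.
move=> [[_ du _ du2] _ _] [[_ dv _ dv2] _ _].
apply: aeOmegaS (aeOmegaI du2 dv2) => x Ox [h1 h2].
have [_ e2] := cderive2_lin a Ox du dv h1 h2.
have [_ e1] := cderivable_lin a (du _ Ox) (dv _ Ox).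
rewrite /apply_op e1 e2; move: (cderive (cderive u) x) (cderive (cderive v) x).
by move: (cderive u x) (cderive v x) => u1 v1 u2 v2; ring.
Qed.

(** Serves to pass to eigenvector coordinates, where each component is a combination of stage
    errors. *)
Lemma homogeneous_domain_sum (I : Type) (r : seq I) (a : I -> R[i])
    (u : I -> R -> R[i]) : (forall i, homogeneous_domain (u i)) ->
  homogeneous_domain (fun x => \sum_(i <- r) a i * u i x) /\
  aeOmega (fun x => apply_op L (fun y => \sum_(i <- r) a i * u i y) x =
                    \sum_(i <- r) a i * apply_op L (u i) x).
Proof.
move=> hu; elim: r => [|i r [IH1 IH2]].
  have -> : (fun x => \sum_(i <- [::]) a i * u i x) = fun=> 0.
    by apply/funext => x; rewrite big_nil.
  split; first exact: homogeneous_domain0.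
  by apply: aeOmega_all => x _; rewrite big_nil apply_op0.
have -> : (fun x => \sum_(j <- i :: r) a j * u j x) =
    (fun x => a i * u i x + \sum_(j <- r) a j * u j x).
  by apply/funext => x; rewrite big_cons.
split; first exact: homogeneous_domain_lin.
apply: aeOmegaS (aeOmegaI IH2 (apply_op_lin (a i) (hu i) IH1)) => x _ [e1 e2].
by rewrite e2 e1 big_cons.
Qed.

End FunctionSpaces.

(** * Tails of the residual series *)

Section TaylorTails.
Variable R : realType.

Lemma series_tail_bound (f c : nat -> R) (q : nat) (e : R) :
  (forall n, 0 <= c n) -> cvgn (series c) ->
  (forall n, (q <= n)%N -> `|f n| <= e * c n) -> 0 <= e ->
  `|limn (series f) - \sum_(n < q) f n| <= e * limn (series c).
Proof.
move=> c0 cc hf e0.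
(* The tail is the series of [f] with its first [q] terms set to zero, so the comparison test
   applies from index 0 on. *)
pose g n := if (n < q)%N then 0 else f n.
have hg n : `|g n| <= (e *: c) n.
  rewrite /g /=; case: ltnP => [_|/hf//].
  by rewrite normr0 mulr_ge0.
have cec : cvgn (series (e *: c)) by apply: is_cvg_seriesZ.
have cng : cvgn [normed series g].
  by apply: series_le_cvg cec => // n; rewrite /= ?mulr_ge0// (le_trans _ (hg n)).
have cg : cvgn (series g) := normed_cvg cng.
have lef : limn (series f) = limn (series g) + \sum_(n < q) f n.
  apply: cvg_lim => //.
  have h : (series g n + \sum_(n < q) f n) @[n --> \oo] -->
      limn (series g) + \sum_(n < q) f n by apply: cvgD cg (cvg_cst _).
  apply: cvg_trans h; apply: near_eq_cvg.
  exists q => // n /= qn.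
  have -> : series g n = \sum_(q <= k < n) f k.
    rewrite /series /= (big_cat_nat (leq0n q) qn) /= big1_seq ?add0r.
      apply: eq_big_nat => k /andP[qk _]; by rewrite /g ltnNge qk.
    by move=> k; rewrite mem_index_iota /g => /andP[_ /andP[_ ->]].
  by rewrite addrC -(big_mkord xpredT) -big_cat_nat.
rewrite lef addrK.
apply: le_trans (lim_series_norm cng) _.
have <- : limn (series (e *: c)) = e * limn (series c) by rewrite lim_seriesZ.
exact: lim_series_le.
Qed.


Lemma cseries_tail_bound (a : nat -> R[i]) (c : nat -> R) (q : nat) (e : R) :
  (forall n, 0 <= c n) -> cvgn (series c) -> 0 <= e ->
  (forall n, (q <= n)%N -> cabs (a n) <= e * c n) ->
  cabs (cseries a - \sum_(n < q) a n) <= e * (2 * limn (series c)).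
Proof.
move=> c0 cc e0 ha.
have hr := @series_tail_bound (fun n => complex.Re (a n)) c q e c0 cc
  (fun n qn => le_trans (Re_le_cabs _) (ha n qn)) e0.
have hi := @series_tail_bound (fun n => complex.Im (a n)) c q e c0 cc
  (fun n qn => le_trans (Im_le_cabs _) (ha n qn)) e0.
have ReS : complex.Re (\sum_(n < q) a n) = \sum_(n < q) complex.Re (a n).
  by elim/big_ind2: _ => // x1 x2 y1 y2 <- <-; rewrite ReD.
have ImS : complex.Im (\sum_(n < q) a n) = \sum_(n < q) complex.Im (a n).
  by elim/big_ind2: _ => // x1 x2 y1 y2 <- <-; rewrite ImD.
apply: le_trans (cabs_le_ReIm _) _.
rewrite ReD ImD ReN ImN ReS ImS /=; lra.
Qed.

(** The common shape of the terms in [delta_stage] and [delta_step]; [d] is the sequence of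
    residuals, shifted so that [n] stands for j - 1. *)
Definition taylor_term (omega dt : R) (d : nat -> R) (n : nat) : R[i] :=
  (omega*i) ^+ n.+1 * (dt%:C) ^+ n.+1 / n`!%:R * (d n)%:C.

(** The terms are dominated by dt^(n+1) times those of an exponential series, and dt <= 1 gives
    dt^(n+1) <= dt^(q+1) for n >= q. The constant comes before [d], so that it serves all stages at
    once. *)
Lemma taylor_cseries_tail (omega rho B : R) : 0 <= rho -> 0 <= B ->
  exists2 C : R, 0 <= C & forall d : nat -> R,
    (forall n, `|d n| <= B * rho ^+ n) -> forall q dt, 0 < dt <= 1 ->
    cabs (cseries (taylor_term omega dt d) -
          \sum_(n < q) taylor_term omega dt d n) <= C * dt ^+ q.+1.
Proof.
move=> rho0 B0.
pose c n := (`|omega| * B) * exp_coeff (`|omega| * rho) n.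
have c0 n : 0 <= c n by rewrite !mulr_ge0 ?exprn_ge0 ?mulr_ge0 ?invr_ge0.
have cc : cvgn (series c).
  have -> : c = (`|omega| * B) *: exp_coeff (`|omega| * rho) by [].
  by apply: is_cvg_seriesZ; exact: is_cvg_series_exp_coeff.
have l0 : 0 <= limn (series c).
  by apply: limr_ge => //; apply: nearW => n; rewrite /series /= sumr_ge0.
exists (2 * limn (series c)); first by rewrite mulr_ge0.
move=> d hd q dt /andP[dt0 dt1].
set a := taylor_term omega dt d.
rewrite mulrC; apply: cseries_tail_bound => // [|n qn].
  by rewrite exprn_ge0 ?ltW.
have omi : cabs (omega*i) = `|omega| by rewrite /= expr0n /= add0r sqrtr_sqr.
have hf : cabs (n`!%:R : R[i]) = n`!%:R.
  by rewrite -[n`!%:R](rmorph_nat (real_complex R)) cabs_real normr_nat.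
have -> : cabs (a n) = `|omega| ^+ n.+1 / n`!%:R * `|d n| * dt ^+ n.+1.
  rewrite /a /taylor_term !Normc.normcM Normc.normcV !cabsX omi !cabs_real hf.
  by rewrite (gtr0_norm dt0); ring.
have h1 : dt ^+ n.+1 <= dt ^+ q.+1 by rewrite ler_wiXn2l// ltW.
have h2 : `|omega| ^+ n.+1 / n`!%:R * `|d n| <= c n.
  have -> : c n = `|omega| ^+ n.+1 / n`!%:R * (B * rho ^+ n).
    by rewrite /c /exp_coeff /= exprMn exprS; ring.
  by rewrite ler_wpM2l// divr_ge0 ?exprn_ge0.
by rewrite [leRHS]mulrC ler_pM// ?exprn_ge0 ?(ltW dt0).
Qed.

End TaylorTails.

(** * Growth of the residuals and the quadrature order conditions *)

Section ResidualSeries.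
Variables (R : realType) (s : nat) (A : 'M[R]_s) (b : 'cV[R]_s).

Let c := abscissae A.
(** A common bound for all the abscissae; thanks to the summand 1, its powers also dominate
    1/(n+1). *)
Let rho := 1 + \sum_k `|c k 0|.

Let rho1 : 1 <= rho.
Proof. by rewrite lerDl sumr_ge0. Qed.

Let crho k n : `|c k 0 ^+ n| <= rho ^+ n.
Proof.
have ck : `|c k 0| <= rho.
  by rewrite /rho (bigD1 k)//= addrCA lerDl addr_ge0// sumr_ge0.
by rewrite normrX lerXn2r// nnegrE (le_trans _ ck).
Qed.

Lemma stage_residual_growth : exists r B : R, [/\ 0 <= r, 0 <= B &
  forall k n, `|stage_residual A n.+1 k 0| <= B * r ^+ n].
Proof.
have rho0 : 0 <= rho by exact: le_trans rho1.
(* The double sum takes care of A c^n; the extra [rho] pays for the additional factor in c^(n+1). *)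
exists rho, (\sum_k \sum_l `|A k l| + rho); split=> //.
  by rewrite addr_ge0// sumr_ge0// => k _; rewrite sumr_ge0.
move=> k n; rewrite /stage_residual /= !mxE (le_trans (ler_normB _ _))// mulrDl.
apply: lerD.
  apply: (le_trans (ler_norm_sum _ _ _)).
  apply: (@le_trans _ _ ((\sum_l `|A k l|) * rho ^+ n)).
    rewrite mulr_suml ler_sum// => l _; rewrite normrM ler_wpM2l//.
    by rewrite [cvpow _ _ _ _]mxE; exact: crho.
  rewrite ler_wpM2r ?exprn_ge0 ?(le_trans ler01)//.
  by rewrite [leRHS](bigD1 k)//= lerDl sumr_ge0// => i _; rewrite sumr_ge0.
rewrite -exprS normrM -[leRHS]mul1r ler_pM//.
  by rewrite normfV normr_nat invf_le1 ?ltr0n// ler1n.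
by have := crho k n.+1; rewrite /c !mxE.
Qed.

Lemma step_residual_growth : exists r B : R, [/\ 0 <= r, 0 <= B &
  forall n, `|(b^T *m cvpow c n) 0 0 - n.+1%:R^-1| <= B * r ^+ n].
Proof.
exists rho, (\sum_k `|b k 0| + 1); split; first exact: le_trans rho1.
  by rewrite addr_ge0// sumr_ge0.
move=> n; rewrite !mxE (le_trans (ler_normB _ _))// mulrDl.
apply: lerD.
  apply: (le_trans (ler_norm_sum _ _ _)).
  rewrite mulr_suml ler_sum// => l _; rewrite normrM mxE ler_wpM2l//.
  by rewrite [cvpow _ _ _ _]mxE; exact: crho.
rewrite mul1r normfV normr_nat (@le_trans _ _ 1)// ?exprn_ege1//.
by rewrite invf_le1 ?ltr0n// ler1n.
Qed.

(** The order condition of the bushy tree, a root carrying [n] leaves, whose density is n + 1. *)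
Lemma order_bushy_tree p n : has_order A b p -> (n < p)%N ->
  (b^T *m cvpow c n) 0 0 = n.+1%:R^-1.
Proof.
move=> ho np; pose t := RNode (nseq n (RNode [::])).
have ot : rtree_order t = n.+1 by rewrite /= map_nseq sumn_nseq mul1n.
have dt : rtree_density t = n.+1.
  have hprod : (\prod_(g <- map rtree_density (nseq n (RNode [::]))) g = 1)%N.
    rewrite map_nseq big_nseq; elim: n {np t ot} => //= n ->.
    by rewrite big_nil.
  by rewrite -ot -[RHS]muln1 -hprod.
have <- : stage_weight A t = cvpow c n.
  have leaf : stage_weight A (RNode [::]) = ones.
    by apply/matrixP => k l; rewrite !mxE big_nil.
  apply/matrixP => i j; rewrite ord1 [stage_weight _ _]/= map_nseq !mxE big_nseq.
  by rewrite leaf iter_mulr mulr1 !mxE.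
by rewrite ho ?ot// dt.
Qed.

End ResidualSeries.

(** * Solving the stage system inside a Krylov space *)

Section KrylovSolution.
Variables (R : realType) (s : nat) (A : 'M[R]_s) (b : 'cV[R]_s).
Variable L : diffop (R := R).
Implicit Types (v : 'cV[R[i]]_s) (f y : R -> R[i]) (z : R[i]).

(** Says that [b] annihilates the Krylov space of A generated by [v]. This is what remains of weak
    stage order after passing from real to complex vectors. *)
Definition krylov_orthogonal v :=
  forall j, (cmx b)^T *m iter j (mulmx (cmx A)) v = 0.

Lemma krylov_orthogonal_mulmx v :
  krylov_orthogonal v -> krylov_orthogonal (cmx A *m v).
Proof. by move=> kv j; rewrite -iterSr; exact: kv. Qed.

Lemma krylov_orthogonal_lin z v w : krylov_orthogonal v ->
  krylov_orthogonal w -> krylov_orthogonal (z *: v + w).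
Proof.
move=> kv kw j.
have -> : iter j (mulmx (cmx A)) (z *: v + w) =
    z *: iter j (mulmx (cmx A)) v + iter j (mulmx (cmx A)) w.
  by elim: j => //= j ->; rewrite mulmxDr -scalemxAr.
by rewrite mulmxDr -scalemxAr kv kw scaler0 addr0.
Qed.

Lemma krylov_orthogonal0 : krylov_orthogonal 0.
Proof.
move=> j; suff -> : iter j (mulmx (cmx A)) 0 = 0 :> 'cV_s by rewrite mulmx0.
by elim: j => //= j ->; rewrite mulmx0.
Qed.

Lemma krylov_orthogonal_sum n (a : nat -> R[i]) (v : nat -> 'cV_s) :
  (forall i, (i < n)%N -> krylov_orthogonal (v i)) ->
  krylov_orthogonal (\sum_(i < n) a i *: v i).
Proof.
elim: n => [|n IH] hv; first by rewrite big_ord0; exact: krylov_orthogonal0.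
rewrite big_ord_recr /= addrC; apply: krylov_orthogonal_lin; first exact: hv.
by apply: IH => i /ltnW; exact: hv.
Qed.

Lemma krylov_orthogonal_stage_residual q j : has_weak_stage_order A b q ->
  (1 <= j <= q)%N -> krylov_orthogonal (cmx (stage_residual A j)).
Proof.
move=> [V [hV stab]] /hV tauV i.
suff [v -> vV] : exists2 v : 'cV_s,
    iter i (mulmx (cmx A)) (cmx (stage_residual A j)) = cmx v & v \in V.
  by rewrite /cmx map_trmx -map_mxM; have [-> _] := stab _ vV; rewrite map_mx0.
elim: i => [|i [v hv vV]]; first by exists (stage_residual A j).
exists (A *m v); last by case: (stab _ vV).
by rewrite iterS hv /cmx map_mxM.
Qed.

(** Cayley-Hamilton with the characteristic polynomial split over the complex numbers: applying its
    factors A - z in turn kills every vector, so the recursion below ends with zero. *)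
Lemma newton_annihilation : exists rs : seq R[i],
  (forall z, z \in rs -> eigenvalue (cmx A) z) /\
  forall v, foldl (fun w z => cmx A *m w - z *: w) v rs = 0.
Proof.
case: s A => [|n] B.
  by exists [::]; split=> // v; apply/matrixP => -[].
have [rs hrs] := closed_field_poly_normal (char_poly (cmx B)).
rewrite (monicP (char_poly_monic _)) scale1r in hrs.
exists rs; split=> [z zrs|v].
  by rewrite eigenvalue_root_char hrs root_prod_XsubC.
have : horner_mx (cmx B) (\prod_(z <- rs) ('X - z%:P)) *m v = 0.
  by rewrite -hrs Cayley_Hamilton mul0mx.
elim: rs v {hrs} => [|z rs IH] v.
  by rewrite big_nil rmorph1 mul1mx.
rewrite big_cons mulrC rmorphM /= -mulmxA rmorphB /= horner_mx_X horner_mx_C.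
by rewrite mulmxBl mul_scalar_mx => /IH.
Qed.

(* The solution is sought as a sum of [y_j v_j] with [v_0 = v] and
   [v_(j+1) = (A - z_j) v_j], the [z_j] being the roots of the characteristic
   polynomial: this decouples the system even if [A] is not diagonalizable, as
   [y_j] solves [y_j - dt z_j L y_j = f_j] with [f_0 = f] and
   [f_(j+1) = dt L y_j].  In [f_(j+1)] the second derivative is avoided by
   writing [dt L y_j = (y_j - f_j) / z_j]. *)
Lemma krylov_solution (K theta1 dt : R) :
  uniform_resolvent_bound L K theta1 -> 0 < dt ->
  forall rs v f,
    (forall z, z \in rs -> z != 0 /\ ~ wedge theta1 (dt%:C * z)) ->
    krylov_orthogonal v -> in_Linf f ->
    foldl (fun w z => cmx A *m w - z *: w) v rs = 0 ->
  exists E : 'I_s -> R -> R[i],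
    [/\ forall k, homogeneous_domain (E k),
      aeOmega (fun x => \col_k E k x -
        dt%:C *: (cmx A *m \col_k apply_op L (E k) x) = f x *: v) &
      aeOmega (fun x => (cmx b)^T *m \col_k apply_op L (E k) x = 0)].
Proof.
move=> ha dt0; have dtC : dt%:C != 0 by rewrite eq_complex /= gt_eqF.
elim=> [|z rs IH] v f hrs kv inf /= hf.
  exists (fun _ _ => 0); split.
  - by move=> _; exact: homogeneous_domain0.
  - apply: aeOmega_all => x _; rewrite apply_op0 hf scaler0.
    have -> : \col_(k < s) (0 : R[i]) = 0 by apply/matrixP => i j; rewrite !mxE.
    by rewrite mulmx0 scaler0 subr0.
  - apply: aeOmega_all => x _; rewrite apply_op0.
    have -> : \col_(k < s) (0 : R[i]) = 0 by apply/matrixP => i j; rewrite !mxE.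
    by rewrite mulmx0.
have [z0 hz] := hrs z (mem_head _ _).
have [y [[hy ey] _ _]] := ha _ hz (mulf_neq0 dtC z0) _ inf.
pose v' := cmx A *m v - z *: v.
(* Written as nested linear combinations, with a final zero, so that [in_Linf_lin] applies twice. *)
pose f' x := z^-1 * y x + (- z^-1 * f x + 0).
have inf' : in_Linf f'.
  apply: in_Linf_lin; first exact/ccontinuous_in_Linf/homogeneous_domain_ccontinuous.
  exact: in_Linf_lin inf (@in_Linf0 R).
have kv' : krylov_orthogonal v'.
  rewrite /v' addrC -scaleNr; apply: krylov_orthogonal_lin => //.
  exact: krylov_orthogonal_mulmx.
have hrs' w : w \in rs -> w != 0 /\ ~ wedge theta1 (dt%:C * w).
  by move=> wrs; apply: hrs; rewrite in_cons wrs orbT.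
have [E' [hE' eE' bE']] := IH v' f' hrs' kv' inf' hf.
exists (fun k x => v k 0 * y x + E' k x).
have hop : aeOmega (fun x => forall k,
    apply_op L (fun x => v k 0 * y x + E' k x) x =
    v k 0 * apply_op L y x + apply_op L (E' k) x).
  by apply: aeOmega_forall => k; exact: apply_op_lin.
have colE (x : R) : (forall k, apply_op L (fun x => v k 0 * y x + E' k x) x =
    v k 0 * apply_op L y x + apply_op L (E' k) x) ->
    \col_k apply_op L (fun x => v k 0 * y x + E' k x) x =
    apply_op L y x *: v + \col_k apply_op L (E' k) x.
  by move=> h; apply/matrixP => i j; rewrite ord1 !mxE h mulrC.
split.
- by move=> k; exact: homogeneous_domain_lin.
- apply: aeOmegaS (aeOmegaI hop (aeOmegaI ey eE')) => x _ [/colE -> [e1 e2]].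
  have -> : \col_k (v k 0 * y x + E' k x) = y x *: v + \col_k E' k x.
    by apply/matrixP => i j; rewrite ord1 !mxE mulrC.
  (* Since A v = v' + z v, the [v]-part of the left side is y - dt z L y = f. The surplus - dt (L y)
     v' is cancelled by the right side f' v' of the recursive solution. *)
  have Av : cmx A *m v = v' + z *: v by rewrite /v' subrK.
  have f'E : f' x = dt%:C * apply_op L y x.
    by rewrite /f' -e1; field.
  rewrite mulmxDr scalerDr opprD addrACA e2 f'E -scalemxAr Av -e1.
  move: (apply_op L y x) (dt%:C) => l d; clearbody v'.
  by apply/matrixP => i j; rewrite !mxE; ring.
- apply: aeOmegaS (aeOmegaI hop bE') => x _ [/colE -> e].
  by rewrite mulmxDr e -scalemxAr (kv 0%N) scaler0 addr0.
Qed.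

End KrylovSolution.

(** * Algebra of the error equations at a point *)

Section ErrorEquation.
Variables (R : realType) (s : nat) (A : 'M[R]_s) (b : 'cV[R]_s).

Lemma mulmx_diag_entry n (D : 'M[R[i]]_n) (v : 'cV_n) k :
  is_diag_mx D -> (D *m v) k 0 = D k k * v k 0.
Proof.
move=> /is_diag_mxP hD; rewrite mxE (bigD1 k)//= big1 ?addr0// => j jk.
by rewrite hD ?mul0r// eq_sym.
Qed.

Lemma mxopnorm_ge0 (M : 'M[R[i]]_s) : 0 <= mxopnorm M.
Proof. by apply: le_trans (bigmax_ge_id _ _ _ _). Qed.

Lemma mxopnorm_mulmx_le (M : 'M[R[i]]_s) (v : 'cV_s) (m : R) k :
  0 <= m -> (forall l, cabs (v l 0) <= m) ->
  cabs ((M *m v) k 0) <= mxopnorm M * m.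
Proof.
move=> m0 hv; rewrite mxE (le_trans (cabs_sum _ _ _))//.
apply: (@le_trans _ _ ((\sum_j cabs (M k j)) * m)).
  rewrite mulr_suml ler_sum// => j _; rewrite Normc.normcM.
  by rewrite ler_wpM2l ?cabs_ge0.
by rewrite ler_wpM2r//; apply: (le_bigmax _ (fun i => \sum_j cabs (M i j))).
Qed.

(* [V] carries the residual component [dV], which [b] does not see; what is
   left of the stage error only involves [dR] and [d0]. *)
Lemma eliminate_step_error (z w d u e0 d0 : R[i]) (E LE V LV dV dR : 'cV[R[i]]_s) :
  z != 0 -> w = z - 1 -> w != 0 ->
  E - (z^-1 * e0) *: cmx ones - d *: (cmx A *m LE) = z^-1 *: (u *: (dV + dR)) ->
  w * e0 = z * d * ((cmx b)^T *m LE) 0 0 + u * d0 ->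
  V - d *: (cmx A *m LV) = (z^-1 * u) *: dV ->
  (cmx b)^T *m LV = 0 ->
  (E - V) - (d / w) *: ((cmx ones *m (cmx b)^T + w *: cmx A) *m (LE - LV)) =
    u *: (z^-1 *: (dR + (d0 / w) *: cmx ones)) /\
  (A \in unitmx ->
    (w + ((b^T *m invmx A *m ones) 0 0)%:C) * e0 =
    z * ((cmx b)^T *m invmx (cmx A) *m (E - V)) 0 0 + u * d0
    - u * ((cmx b)^T *m invmx (cmx A) *m dR) 0 0).
Proof.
move=> z0 wE w0 h1 h2 h3 h4.
set B := ((cmx b)^T *m LE) 0 0 in h2.
have hB : (cmx b)^T *m (LE - LV) = B%:M.
  by rewrite mulmxBr h4 subr0 [LHS]mx11_scalar.
have h5 : (E - V) - d *: (cmx A *m (LE - LV)) =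
    (z^-1 * u) *: dR + (z^-1 * e0) *: cmx ones.
  have -> : E = z^-1 *: (u *: (dV + dR)) + d *: (cmx A *m LE)
      + (z^-1 * e0) *: cmx ones by rewrite -h1 !subrK.
  have -> : V = (z^-1 * u) *: dV + d *: (cmx A *m LV) by rewrite -h3 subrK.
  rewrite mulmxBr; move: (cmx A *m LE) (cmx A *m LV) => X Y.
  by apply/matrixP => i j; rewrite !mxE; ring.
(* Substituting this into [h5] turns the term in e0 into (d/w) e b^T acting on [LE - LV], the
   rank-one part of the stage matrix. *)
have e0E : e0 = (z * d * B + u * d0) / w by rewrite -h2 mulrC mulKf.
split.
  rewrite mulmxDl -mulmxA hB -scalemxAl scalerDr opprD addrCA.
  rewrite (scalerA (d / w) w) divfK// h5 mul_mx_scalar e0E.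
  by apply/matrixP => i j; rewrite !mxE; field; rewrite z0 w0.
move=> unitA.
(* Applying b^T A^-1 to [h5] leaves d B as the only trace of the operator. Eliminating it with the
   step equation recovers e0 without dividing by the small number [w]. *)
pose g := (cmx b)^T *m invmx (cmx A).
have h6 : g *m (E - V) - d *: (g *m (cmx A *m (LE - LV))) =
    (z^-1 * u) *: (g *m dR) + (z^-1 * e0) *: (g *m cmx ones).
  by rewrite [d *: _]scalemxAr -mulmxBr h5 mulmxDr -!scalemxAr.
move: h6; rewrite [in X in _ - _ *: X]/g [X in _ - _ *: X]mulmxA mulmxKV ?cmx_unit// hB.
move=> /matrixP/(_ 0 0).
have entD (X Y : 'M[R[i]]_1) : (X + Y) 0 0 = X 0 0 + Y 0 0 by rewrite mxE.
have entN (X : 'M[R[i]]_1) : (- X) 0 0 = - X 0 0 by rewrite mxE.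
have entZ a (X : 'M[R[i]]_1) : (a *: X) 0 0 = a * X 0 0 by rewrite mxE.
rewrite !(entD, entN, entZ) beta_cmx [B%:M 0 0]mxE eqxx mulr1n.
move: (_%:C) => beta.
set gE := (g *m (E - V)) 0 0; set gR := (g *m dR) 0 0 => h6.
have -> : gE = z^-1 * u * gR + z^-1 * e0 * beta + d * B by rewrite -h6 subrK.
by rewrite mulrDl h2; field.
Qed.

End ErrorEquation.

(** * The resolvent bound for a given solution *)

Section ResolventEstimate.
Variables (R : realType) (L : diffop (R := R)).

Lemma Linf_norm_ge0 (u : R -> R[i]) : (0 <= Linf_norm u)%E.
Proof.
(* The lower bound requires the whole line to have positive measure, which is seen on [0, 1]. *)
apply: ess_sup_gee.
  apply: (@lt_le_trans _ _ (lebesgue_measure (`[0 : R, 1]%classic))).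
    by rewrite lebesgue_measure_itv /= lte_fin ltr01 oppr0 adde0.
  by apply: le_measure => //; rewrite inE; [exact: measurable_itv|exact: measurableT].
apply: aeW => x /=; rewrite lee_fin patchE; case: ifP => // _.
exact: cabs_ge0.
Qed.

(** The hypothesis bounds some solution; uniqueness carries the bound over to [y]. The absolute
    value appears because [K] has no prescribed sign. *)
Lemma resolvent_estimate (K theta1 F : R) lambda (f y : R -> R[i]) :
  uniform_resolvent_bound L K theta1 -> ~ wedge theta1 lambda -> lambda != 0 ->
  in_Linf f -> resolvent_solution L lambda f y -> 0 <= F ->
  aeOmega (fun x => cabs (f x) <= F) ->
  aeOmega (fun x => cabs (y x) <= `|K| * F).
Proof.
move=> ha hl l0 inf ry F0 /(Linf_norm_le _ F0) hF.
have [u [ru uniq hu]] := ha _ hl l0 _ inf.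
have : aeOmega (fun x => cabs (u x) <= `|K| * F).
  apply/Linf_norm_le; first by rewrite mulr_ge0.
  apply: (le_trans hu); rewrite EFinM.
  apply: (@le_trans _ _ (`|K|%:E * Linf_norm f)%E).
    by apply: lee_wpmul2r; [exact: Linf_norm_ge0|rewrite lee_fin ler_norm].
  by apply: lee_wpmul2l; rewrite ?lee_fin.
by apply: aeOmegaS => x Ox; rewrite (uniq _ ry _ (Omega_clOmega Ox)).
Qed.

End ResolventEstimate.

(** * Size of exp(i x) - 1 for small x *)

Section ExpiNearOne.
Variable R : realType.

(** The lower bound comes from sin x / x -> 1 and limits the cost of dividing by [w] to one power of
    dt. The upper bound, from continuity, keeps [w] in the range where diagonalization and w + beta
    != 0 are available. *)
Lemma expi_sub1_near (e : R) : 0 < e -> exists2 r : R, 0 < r &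
  forall x, x != 0 -> `|x| < r ->
    `|x| / 2 <= cabs (expi x - 1) /\ cabs (expi x - 1) < e.
Proof.
move=> e0.
have ds : is_derive (0 : R) 1 (@sin R) 1.
  by rewrite -[X in is_derive _ _ _ X]cos0; exact: is_derive_sin.
have hs : sin x / x @[x --> (0 : R)^'] --> (1 : R).
  have [/cvg_ex[l hl] dl] := ds.
  have := hl; rewrite /derive in dl; have -> : l = 1.
    by rewrite -dl; apply/esym/cvg_lim.
  apply: cvg_trans; apply: near_eq_cvg; near=> x.
  by rewrite /= addr0 sin0 subr0 mulrC [x *: 1]mulr1.
have cc : cos x @[x --> (0 : R)] --> (1 : R).
  by rewrite -[X in _ --> X]cos0; exact: continuous_cos.
have cs : sin x @[x --> (0 : R)] --> (0 : R).
  by rewrite -[X in _ --> X]sin0; exact: continuous_sin.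
have half : 0 < 1 / 2 :> R by lra.
have e2 : 0 < e / 2 by lra.
have /cvgrPdist_lt/(_ _ half)[r1 r10 h1] := hs.
have /cvgrPdist_lt/(_ _ e2)[r2 r20 h2] := cc.
have /cvgrPdist_lt/(_ _ e2)[r3 r30 h3] := cs.
exists (Num.min r1 (Num.min r2 r3)); first by rewrite !lt_min r10 r20.
move=> x x0; rewrite !lt_min => /and3P[x1 x2 x3].
suff key (v : R[i]) : complex.Re v = cos x - 1 -> complex.Im v = sin x ->
    `|x| / 2 <= cabs v /\ cabs v < e.
  by apply: key; [rewrite ReD ReN|rewrite ImD ImN /= oppr0 addr0].
move=> eR eI; split.
  apply: le_trans (Im_le_cabs v); rewrite eI.
  have := h1 x; rewrite /= sub0r normrN => /(_ x1 x0) hh.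
  have h4 : 1 / 2 <= `|sin x / x|.
    by have := ler_norm (1 - sin x / x); have := ler_norm (sin x / x); lra.
  by move: h4; rewrite normrM normfV ler_pdivlMr ?normr_gt0//; lra.
apply: le_lt_trans (cabs_le_ReIm v) _; rewrite eR eI.
have := h2 x; rewrite /= sub0r normrN distrC => /(_ x2).
have := h3 x; rewrite /= !sub0r !normrN => /(_ x3).
lra.
Unshelve. all: by end_near.
Qed.

End ExpiNearOne.

(** * The error bound for one fixed time step *)

Section StepErrorBound.
Variables (R : realType) (s : nat) (A : 'M[R]_s) (b : 'cV[R]_s).
Variables (L : diffop (R := R)) (K theta1 theta2 delta_d c_d omega : R).
Variables (U : R -> R[i]) (Cu : R).

Let beta := (b^T *m invmx A *m ones) 0 0.
Let g := (cmx b)^T *m invmx (cmx A).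
Let G := \sum_k cabs (g 0 k).

(** The factor 2/|beta| inverts w + beta; the three summands bound the three terms in the formula
    that recovers [eps0], the first through the bound on the remaining stage error. *)
Definition error_constant : R :=
  2 / `|beta| * (G * (`|K| * (2 * Cu * c_d)) + Cu + Cu * G).

Hypothesis theta1_bounds : 0 < theta1 < pi / 2.
Hypothesis resolvent : uniform_resolvent_bound L K theta1.
Hypothesis theta2_bounds : theta1 < theta2 <= pi / 2.
Hypothesis stable : wedge theta2 `<=` stability_region A b.
Hypothesis spectrum : forall a : R[i], eigenvalue (cmx A) a -> 0 <= complex.Re a.
Hypothesis diagonalizable : uniformly_diagonalizable A b delta_d c_d.
Hypothesis unitA : A \in unitmx.
Hypothesis beta0 : beta != 0.
Hypothesis ccontinuousU : ccontinuous U.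
Hypothesis boundU : forall x, clOmega x -> cabs (U x) <= Cu.

Let theta1_pi : 0 < theta1 <= pi / 2.
Proof. by case/andP: theta1_bounds => -> /ltW ->. Qed.

Let theta2_pi : 0 < theta2 <= pi / 2.
Proof. by have := theta1_bounds; have := theta2_bounds; lra. Qed.

Let Cu0 : 0 <= Cu.
Proof.
by apply: le_trans (boundU (x := 0) _); [exact: cabs_ge0|rewrite /clOmega /= lexx ler01].
Qed.

Let G0 : 0 <= G. Proof. by apply: sumr_ge0 => k _; exact: cabs_ge0. Qed.

Lemma error_constant_ge0 : 0 < c_d -> 0 <= error_constant.
Proof.
by move=> c0; rewrite !(mulr_ge0, addr_ge0)// ?invr_ge0// ltW.
Qed.

Let row_bound (v : 'cV[R[i]]_s) (m : R) : (forall k, cabs (v k 0) <= m) ->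
  cabs ((g *m v) 0 0) <= G * m.
Proof.
move=> hv; rewrite mxE (le_trans (cabs_sum _ _ _))// mulr_suml ler_sum// => k _.
by rewrite Normc.normcM ler_wpM2l ?cabs_ge0.
Qed.

Lemma in_Linf_scale a : in_Linf (fun x => a * U x).
Proof.
have -> : (fun x => a * U x) = (fun x => a * U x + 0).
  by apply/funext => x; rewrite addr0.
exact: in_Linf_lin (ccontinuous_in_Linf ccontinuousU) (@in_Linf0 R).
Qed.

Section FixedStep.
Variables (dt m : R) (dV dR : 'cV[R[i]]_s) (d0 : R[i]).

Let z := expi (omega * dt).
Let w := z - 1.

Hypothesis dt0 : 0 < dt.
Hypothesis w0 : w != 0.
Hypothesis w_small : cabs w < delta_d.
Hypothesis w_beta : cabs w <= `|beta| / 2.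
Hypothesis dV_orthogonal : krylov_orthogonal A b dV.
Hypothesis dR_le : forall k, cabs (dR k 0) <= m.
Hypothesis d0_le : cabs d0 <= m.
Hypothesis d0w_le : cabs (d0 / w) <= m.
Hypothesis delta_stageE :
  forall x, delta_stage A omega U dt x = U x *: (dV + dR).
Hypothesis delta_stepE : forall x, delta_step A b omega U dt x = U x * d0.

Let z0 : z != 0.
Proof. by rewrite -cabs_gt0 cabs_expi. Qed.

Let m0 : 0 <= m.
Proof. exact: le_trans (cabs_ge0 _) d0_le. Qed.

Let dtC : dt%:C != 0 :> R[i].
Proof. by rewrite eq_complex /= gt_eqF. Qed.

(** The eigenvalues of A are nonzero, A being invertible, and lie in the closed right half-plane.
    Their multiples by dt > 0 therefore avoid the wedge, as the Krylov construction requires. *)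
Lemma weak_stage_component : exists E : 'I_s -> R -> R[i],
  [/\ forall k, homogeneous_domain (E k),
    aeOmega (fun x => \col_k E k x -
      dt%:C *: (cmx A *m \col_k apply_op L (E k) x) = (z^-1 * U x) *: dV) &
    aeOmega (fun x => (cmx b)^T *m \col_k apply_op L (E k) x = 0)].
Proof.
have [rs [hrs ann]] := newton_annihilation A.
apply: (krylov_solution resolvent dt0 _ dV_orthogonal (in_Linf_scale z^-1) (ann dV)).
move=> a /hrs ea; split.
  apply: contraTneq ea => ->; apply/eigenvalueP => -[v hv v0].
  move: v0; rewrite -[v](mulmxK (cmx_unit unitA)) hv.
  by rewrite scale0r mul0mx eqxx.
apply: not_wedge_Re_ge0 => //.
by rewrite ReM /= mul0r subr0 mulr_ge0 ?spectrum// ltW.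
Qed.

(** Row [k] of the inverse of [T] is a left eigenvector for [D k k], so [stage_eigenvalue] excludes
    the wedge of angle theta2. Scaling by dt > 0 preserves arguments, and theta1 < theta2. *)
Lemma stage_eigenvalue_not_wedge (T : 'M[R[i]]_s) k :
  let D := invmx T *m (cmx ones *m (cmx b)^T + w *: cmx A) *m T in
  T \in unitmx -> is_diag_mx D ->
  dt%:C * (D k k / w) != 0 /\ ~ wedge theta1 (dt%:C * (D k k / w)).
Proof.
move=> D uT diagD.
have l0 : row k (invmx T) != 0.
  apply/eqP => e; have : row k (invmx T *m T) = 0 by rewrite row_mul e mul0mx.
  rewrite mulVmx// => /matrixP/(_ 0 k); rewrite !mxE eqxx => /eqP.
  by rewrite oner_eq0.
have El : row k (invmx T) *m (cmx ones *m (cmx b)^T + w *: cmx A) =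
    D k k *: row k (invmx T).
  rewrite -row_mul.
  have -> : invmx T *m (cmx ones *m (cmx b)^T + w *: cmx A) = D *m invmx T.
    by rewrite /D mulmxK.
  clearbody D; apply/matrixP => i j; rewrite !mxE (bigD1 k)//= big1 ?addr0// => l lk.
  by have /is_diag_mxP -> := diagD; rewrite ?mul0r// eq_sym.
have wb : w + beta%:C != 0.
  apply: contraTneq w_beta => /eqP; rewrite addr_eq0 => /eqP ->.
  rewrite normcN cabs_real -ltNge; have : 0 < `|beta| by rewrite normr_gt0.
  by lra.
have z1 : cabs (1 + w) = 1 by rewrite addrC subrK cabs_expi.
have [D0 nD] := stage_eigenvalue unitA theta2_pi stable w0 wb z1 l0 El.
split; first by rewrite !mulf_neq0 ?invr_neq0.
move=> /(wedge_scale theta1_pi dt0) h; apply: nD; apply: wedge_subset h.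
by apply: ltW; case/andP: theta2_bounds.
Qed.

Lemma step_error_bound eps0 eps :
  periodic_error A b L omega U dt eps0 eps ->
  aeOmega (fun x => cabs (eps0 x) <= error_constant * m).
Proof.
move=> [heps eq1 eq2].
have [V [hV eqV bV]] := weak_stage_component.
have [T [[uT diagD] cond]] := diagonalizable w_small.
set D := invmx T *m _ *m T in diagD.
(* The stage error minus its weak-stage-order part, in the shape expected by the linearity
   lemmas. *)
pose E' k x := (-1) * V k x + eps x k 0.
have hE' k : homogeneous_domain (E' k).
  exact: homogeneous_domain_lin (hV k) (heps k).
have opE' : aeOmega (fun x => forall k, apply_op L (E' k) x =
    (-1) * apply_op L (V k) x + apply_op L (fun y => eps y k 0) x).
  by apply: aeOmega_forall => k; exact: apply_op_lin.
(* Eigenvector coordinates: the components of [Y] solve scalar resolvent equations. *)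
pose Y k x := \sum_l invmx T k l * E' l x.
have hY k := homogeneous_domain_sum L (index_enum 'I_s) (invmx T k) hE'.
have opY : aeOmega (fun x => forall k, apply_op L (Y k) x =
    \sum_l invmx T k l * apply_op L (E' l) x).
  by apply: aeOmega_forall => k; have [] := hY k.
pose r := z^-1 *: (dR + (d0 / w) *: cmx ones).
pose F := Cu * (mxopnorm (invmx T) * (2 * m)).
have r_le k : cabs (r k 0) <= 2 * m.
  rewrite !mxE rmorph1 mulr1 Normc.normcM Normc.normcV cabs_expi invr1 mul1r.
  by rewrite (le_trans (le_normcD _ _))// mulr_natl mulr2n lerD.
have F0 : 0 <= F by rewrite !mulr_ge0// mxopnorm_ge0.
have pointwise : aeOmega (fun x =>
    (\col_k E' k x) - (dt%:C / w) *: ((cmx ones *m (cmx b)^T + w *: cmx A) *m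
      \col_k apply_op L (E' k) x) = U x *: r /\
    (w + beta%:C) * eps0 x = z * (g *m \col_k E' k x) 0 0 + U x * d0
      - U x * (g *m dR) 0 0).
  apply: aeOmegaS (aeOmegaI (aeOmegaI eq1 eq2) (aeOmegaI (aeOmegaI eqV bV) opE')).
  move=> x _ [[e1 e2] [[e3 e4] e5]].
  rewrite delta_stageE in e1; rewrite delta_stepE in e2.
  have [c1 c2] := eliminate_step_error z0 (erefl w) w0 e1 e2 e3 e4.
  have EE : \col_k E' k x = eps x - \col_k V k x.
    by apply/matrixP => i j; rewrite ord1 !mxE /E' mulN1r addrC.
  have LE : \col_k apply_op L (E' k) x =
      \col_k apply_op L (fun y => eps y k 0) x - \col_k apply_op L (V k) x.
    by apply/matrixP => i j; rewrite ord1 !mxE e5 mulN1r addrC.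
  by rewrite EE LE; split; [exact: c1|exact: c2].
have Ybound : aeOmega (fun x => forall k, cabs (Y k x) <= `|K| * F).
  apply: aeOmega_forall => k.
  have [l0 lw] := stage_eigenvalue_not_wedge k uT diagD.
  apply: (resolvent_estimate (f := fun x => (invmx T *m r) k 0 * U x) resolvent lw l0 _ _ F0).
  - exact: in_Linf_scale.
  - split; first by have [] := hY k.
    apply: aeOmegaS (aeOmegaI opY pointwise) => x _ [eY [e _]].
    have DT : D *m invmx T = invmx T *m (cmx ones *m (cmx b)^T + w *: cmx A).
      by rewrite /D mulmxK.
    have : invmx T *m (\col_l E' l x) - (dt%:C / w) *:
        (D *m (invmx T *m \col_l apply_op L (E' l) x)) = U x *: (invmx T *m r).
      by rewrite [D *m _]mulmxA DT -mulmxA [_ *: _]scalemxAr -mulmxBr e -scalemxAr.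
    move=> /matrixP/(_ k 0).
    have entD (X1 X2 : 'cV[R[i]]_s) : (X1 - X2) k 0 = X1 k 0 - X2 k 0 by rewrite !mxE.
    have entZ a (X : 'cV[R[i]]_s) : (a *: X) k 0 = a * X k 0 by rewrite mxE.
    rewrite entD !entZ (@mulmx_diag_entry _ _ D)// => e'.
    rewrite eY [RHS]mulrC -e' /Y !mxE; congr (_ - _).
      by apply: eq_bigr => l _; rewrite mxE.
    have -> : \sum_j invmx T k j * (\col_k0 apply_op L (E' k0) x) j 0 =
        \sum_l invmx T k l * apply_op L (E' l) x.
      by apply: eq_bigr => l _; rewrite mxE.
    by ring.
  - apply: aeOmega_all => x /Omega_clOmega Ox.
    rewrite Normc.normcM mulrC ler_pM ?cabs_ge0 ?boundU//.
    by apply: mxopnorm_mulmx_le => //; rewrite mulr_ge0.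
apply: aeOmegaS (aeOmegaI Ybound pointwise) => x /Omega_clOmega Ox [Yx [_ e]].
(* Undoing the change of basis, E' = T Y, brings the norm of [T] next to that of its inverse in [F].
   Their product is bounded by [c_d], independently of the time step. *)
have E'le k : cabs ((\col_k E' k x) k 0) <= `|K| * (2 * Cu * c_d) * m.
  have -> : \col_k E' k x = T *m \col_k Y k x.
    have -> : \col_k Y k x = invmx T *m \col_k E' k x.
      by apply/matrixP => i j; rewrite !mxE; apply: eq_bigr => l _; rewrite mxE.
    by rewrite mulKVmx.
  have := @mxopnorm_mulmx_le _ _ T (\col_k Y k x) (`|K| * F) k (mulr_ge0 (normr_ge0 _) F0).
  move=> /(_ (fun l => _)) h; apply: (le_trans (h _)) => [l|]; first by rewrite mxE.
  have -> : mxopnorm T * (`|K| * F) =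
      `|K| * (2 * Cu) * m * (mxopnorm T * mxopnorm (invmx T)) by rewrite /F; ring.
  have -> : `|K| * (2 * Cu * c_d) * m = `|K| * (2 * Cu) * m * c_d by ring.
  by apply: ler_wpM2l (ltW cond); rewrite !mulr_ge0.
have Ux := boundU Ox.
(* This holds because |w| <= |beta|/2. *)
have b2 : `|beta| / 2 <= cabs (w + beta%:C).
  have := cabs_triangle beta%:C (- w); rewrite opprK normcN cabs_real [_ + w]addrC.
  by have := w_beta; lra.
have bpos : 0 < `|beta| by rewrite normr_gt0.
have : cabs ((w + beta%:C) * eps0 x) <=
    (G * (`|K| * (2 * Cu * c_d)) + Cu + Cu * G) * m.
  rewrite e (le_trans (cabsB _ _))// mulrDl lerD//; last first.
    by rewrite Normc.normcM -mulrA ler_pM ?cabs_ge0// row_bound.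
  rewrite (le_trans (le_normcD _ _))// mulrDl lerD//; last first.
    by rewrite Normc.normcM ler_pM ?cabs_ge0.
  by rewrite Normc.normcM cabs_expi mul1r -mulrA row_bound.
rewrite Normc.normcM => h.
have : `|beta| / 2 * cabs (eps0 x) <= (G * (`|K| * (2 * Cu * c_d)) + Cu + Cu * G) * m.
  by apply: le_trans h; rewrite ler_wpM2r ?cabs_ge0.
rewrite /error_constant; move: (_ + _ + _) => X.
rewrite mulrC -ler_pdivlMr ?divr_gt0// => h'; apply: (le_trans h').
by rewrite invf_div mulrC mulrA.
Qed.

End FixedStep.

End StepErrorBound.

(** * Splitting the residuals into an annihilated part and a small part *)

Section ResidualSplitting.
Variables (R : realType) (s : nat) (A : 'M[R]_s) (b : 'cV[R]_s).
Variables (omega : R) (U : R -> R[i]).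

Definition low_stage_residual (q : nat) (dt : R) : 'cV[R[i]]_s :=
  \sum_(n < q) ((omega*i) ^+ n.+1 * (dt%:C) ^+ n.+1 / n`!%:R) *:
    cmx (stage_residual A n.+1).

Lemma low_stage_residual_orthogonal q dt : has_weak_stage_order A b q ->
  krylov_orthogonal A b (low_stage_residual q dt).
Proof.
move=> hw; apply: (@krylov_orthogonal_sum _ _ A b q
  (fun n => (omega*i) ^+ n.+1 * (dt%:C) ^+ n.+1 / n`!%:R)
  (fun n => cmx (stage_residual A n.+1))) => n nq.
by apply: (krylov_orthogonal_stage_residual hw); rewrite nq.
Qed.

Lemma delta_stage_split q : exists2 C : R, 0 <= C & forall dt, 0 < dt <= 1 ->
  exists2 dR : 'cV[R[i]]_s, forall k, cabs (dR k 0) <= C * dt ^+ q.+1 &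
    forall x, delta_stage A omega U dt x = U x *: (low_stage_residual q dt + dR).
Proof.
have [rho [B [rho0 B0 hB]]] := stage_residual_growth A.
have [C C0 hC] := taylor_cseries_tail omega rho0 B0.
exists C => // dt dt01.
pose d k n := stage_residual A n.+1 k 0.
exists (\col_k cseries (taylor_term omega dt (d k)) - low_stage_residual q dt).
  move=> k; have -> : (\col_k cseries (taylor_term omega dt (d k))
      - low_stage_residual q dt) k 0 =
      cseries (taylor_term omega dt (d k)) - \sum_(n < q) taylor_term omega dt (d k) n.
    by rewrite !mxE summxE; congr (_ - _); apply: eq_bigr => n _; rewrite 2!mxE.
  by apply: hC => // n; exact: hB.
by move=> x; apply/matrixP => i j; rewrite addrC subrK ord1 !mxE.
Qed.

Lemma delta_step_small p : has_order A b p ->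
  exists2 C : R, 0 <= C & forall dt, 0 < dt <= 1 ->
  exists2 d0 : R[i], cabs d0 <= C * dt ^+ p.+1 &
    forall x, delta_step A b omega U dt x = U x * d0.
Proof.
move=> ho.
have [rho [B [rho0 B0 hB]]] := step_residual_growth A b.
have [C C0 hC] := taylor_cseries_tail omega rho0 B0.
exists C => // dt dt01.
pose d n := (b^T *m cvpow (abscissae A) n) 0 0 - n.+1%:R^-1.
exists (cseries (taylor_term omega dt d)) => //.
(* The first [p] terms vanish by the quadrature conditions, so the whole series is its own tail. *)
have := hC d hB p dt dt01; rewrite big1 ?subr0// => n _.
by rewrite /taylor_term /d (order_bushy_tree ho (ltn_ord n)) subrr mulr0.
Qed.

End ResidualSplitting.

(** * Assembly for all small time steps *)

Theorem theorem3p5 (R : realType) (s p q : nat)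
    (A : 'M[R]_s) (b : 'cV[R]_s)
    (L : diffop (R := R)) (K theta1 theta2 delta_d c_d : R)
    (omega : R) (U fhat ghat : R -> R[i])
    (hp : (1 <= p)%N) (hq : (1 <= q)%N)
    (horder : has_order A b p)
    (hwso : has_weak_stage_order A b q)
    (hL : second_order L)
    (htheta1 : 0 < theta1 < pi / 2)
    (ha : uniform_resolvent_bound L K theta1)
    (htheta2 : theta1 < theta2 <= pi / 2)
    (hb : wedge theta2 `<=` stability_region A b)
    (hc : forall a : R[i], eigenvalue (cmx A) a -> 0 <= complex.Re a)
    (hdelta_d : 0 < delta_d) (hc_d : 0 < c_d)
    (hd : uniformly_diagonalizable A b delta_d c_d)
    (heA : A \in unitmx)
    (heb : (b^T *m invmx A *m ones) 0 0 != 0)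
    (homega : omega != 0)
    (hU : C2_closed U)
    (hsol : periodic_exact_solution L omega U fhat ghat) :
  exists C : R, \forall dt \near 0^'+,
    forall (eps0 : R -> R[i]) (eps : R -> 'cV[R[i]]_s),
      periodic_error A b L omega U dt eps0 eps ->
      (Linf_norm eps0 <= (C * dt ^+ minn p q.+1)%:E)%E.
Proof.
pose beta := (b^T *m invmx A *m ones) 0 0.
have beta_gt0 : 0 < `|beta| by rewrite normr_gt0.
have om0 : 0 < `|omega| by rewrite normr_gt0.
have cU := C2_closed_ccontinuous hU.
have [Cu hCu] := ccontinuous_bounded cU.
have [C1 C10 hC1] := delta_stage_split A omega U q.
have [C2 C20 hC2] := delta_step_small omega U horder.
(* The threshold for |w|: below [delta_d] for diagonalizability, below |beta|/2 to keep w + beta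
   away from zero. *)
have e0 : 0 < Num.min delta_d (`|beta| / 2) by rewrite lt_min hdelta_d divr_gt0.
have [r r0 hr] := expi_sub1_near e0.
pose N := minn p q.+1.
(* One summand for each of the bounds on [dR], [d0] and [d0 / w]. *)
pose Cm := C1 + C2 + 2 * C2 / `|omega|.
pose C := error_constant A b K c_d Cu.
exists (C * Cm).
have dt_small : \forall dt \near (0 : R)^'+, dt < Num.min 1 (r / `|omega|).
  by apply: nbhs_right_lt; rewrite lt_min ltr01 divr_gt0.
have dt_pos : \forall dt \near (0 : R)^'+, 0 < dt by exact: nbhs_right_gt.
apply: filterS2 dt_small dt_pos => dt; rewrite lt_min => /andP[/ltW dt1 dtr] dt0.
move=> eps0 eps herr.
have dt01 : 0 < dt <= 1 by rewrite dt0.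
have [dR hdR stageE] := hC1 _ dt01.
have [d0 hd0 stepE] := hC2 _ dt01.
have odt : `|omega * dt| = `|omega| * dt by rewrite normrM (gtr0_norm dt0).
have odt0 : omega * dt != 0 by rewrite mulf_neq0// gt_eqF.
have odtr : `|omega * dt| < r by rewrite odt mulrC -ltr_pdivlMr.
have [w_ge] := hr _ odt0 odtr; rewrite lt_min => /andP[w_d /ltW w_b].
set w := expi (omega * dt) - 1 in w_ge w_d w_b.
have wpos : 0 < cabs w by apply: lt_le_trans w_ge; rewrite odt divr_gt0// mulr_gt0.
have w0 : w != 0 by rewrite -cabs_gt0.
have dtN n : (N <= n)%N -> dt ^+ n <= dt ^+ N.
  by move=> Nn; rewrite ler_wiXn2l// ltW.
have dtN0 : 0 <= dt ^+ N by rewrite exprn_ge0// ltW.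
have m1 k : cabs (dR k 0) <= C1 * dt ^+ N.
  by apply: le_trans (hdR k) _; rewrite ler_wpM2l ?dtN ?geq_minr.
have m2 : cabs d0 <= C2 * dt ^+ N.
  by apply: le_trans hd0 _; rewrite ler_wpM2l ?dtN// leqW ?geq_minl.
(* Here |w| >= |omega| dt / 2 lowers dt^(p+1) to dt^p, which is why the order [p] enters the minimum
   while the stage remainder contributes q + 1. *)
have m3 : cabs (d0 / w) <= 2 * C2 / `|omega| * dt ^+ N.
  rewrite Normc.normcM Normc.normcV ler_pdivrMr//.
  apply: (@le_trans _ _ (2 * C2 / `|omega| * dt ^+ N * (`|omega| * dt / 2))).
    apply: (le_trans hd0); have -> : 2 * C2 / `|omega| * dt ^+ N * (`|omega| * dt / 2)
      = C2 * (dt * dt ^+ N) by field; rewrite gt_eqF.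
    by rewrite exprS !ler_wpM2l ?(ltW dt0)// dtN ?geq_minl.
  by rewrite ler_wpM2l -?odt// !mulr_ge0 ?invr_ge0.
have mE : Cm * dt ^+ N = C1 * dt ^+ N + C2 * dt ^+ N + 2 * C2 / `|omega| * dt ^+ N.
  by rewrite /Cm !mulrDl.
have p1 : 0 <= C1 * dt ^+ N by rewrite mulr_ge0.
have p2 : 0 <= C2 * dt ^+ N by rewrite mulr_ge0.
have p3 : 0 <= 2 * C2 / `|omega| * dt ^+ N by rewrite !mulr_ge0 ?invr_ge0.
have hm : 0 <= Cm * dt ^+ N by rewrite mE !addr_ge0.
apply/Linf_norm_le.
  by rewrite -mulrA mulr_ge0// (error_constant_ge0 _ _ _ hCu).
rewrite -mulrA.
apply: (step_error_bound htheta1 ha htheta2 hb hc hd heA heb cU hCu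
  (dV := low_stage_residual A omega q dt) (dR := dR) (d0 := d0)) herr => //.
- exact: low_stage_residual_orthogonal.
- by move=> k; rewrite mE; have := m1 k; lra.
- by rewrite mE; lra.
- by rewrite mE; lra.
Qed.
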